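(* Let $C:f=0$ be a reduced plane curve of degree $d$ in $\mathbb{P}^2$ over $\mathbb{C}$, let $r=\mathrm{mdr}(f)$, let $\rho_1\in AR(f)_r$ be a nonzero syzygy and consider the associated subscheme $Z(C,\rho_1)$ of $\mathbb{P}^2$. If $r>d/2$, then the splitting type $(d_1^L,d_2^L)$ of $E_C$ along any line $L$ in $\mathbb{P}^2$ which avoids the support of $Z(C,\rho_1)$ satisfies $d_1^L\ge d-1-r$. In particular, if $2r-d\in\{1,2\}$, then $d_1^L\in\{d_1^{L_0}-1,\,d_1^{L_0}\}$, where $L_0$ is a generic line.
   Context: $S=\mathbb{C}[x,y,z]$ with the usual grading; for a graded module $M$, $M(m)_k=M_{m+k}$; $f\in S_d$ is the reduced homogeneous equation of $C$; $f_x,f_y,f_z$ are its partial derivatives. $AR(f)\subset S^3$ is the graded $S$-module with $AR(f)_k=\{(a,b,c)\in S_k^3: af_x+bf_y+cf_z=0\}$ and $\mathrm{mdr}(f)=\min\{k: AR(f)_k\neq 0\}$. $E_C=\widetilde{AR(f)}$ is the associated rank two vector bundle on $\mathbb{P}^2$. For a line $L$, the splitting type of $E_C$ along $L$ is the pair of integers $d_1^L\le d_2^L$ with $E_C|_L\simeq\mathcal{O}_L(-d_1^L)\oplus\mathcal{O}_L(-d_2^L)$; for a generic line $L_0$ the pair $(d_1^{L_0},d_2^{L_0})$ is constant. Given a nonzero $\rho_1=(a_1,b_1,c_1)\in AR(f)_r$, for $\rho=(a,b,c)\in AR(f)_m$ let $\Delta(\rho)$ be the determinant of the $3\times3$ matrix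 with rows $(x,y,z)$, $(a_1,b_1,c_1)$, $(a,b,c)$; it is divisible by $f$, and $v:AR(f)\to S(r-d+1)$ is the graded morphism $v(\rho)=\Delta(\rho)/f$. The homogeneous ideal $B(C,\rho_1)\subset S$ is defined by $\mathrm{im}\,v=B(C,\rho_1)(r-d+1)$, and $Z(C,\rho_1)=V(B(C,\rho_1))\subset\mathbb{P}^2$ is the subscheme it defines (of dimension at most $0$). *)

(* Defs.v *)
From HB Require Import structures.
From mathcomp Require Import all_boot all_order all_algebra.
From mathcomp Require Import complex.
From mathcomp Require Import reals.
From mathcomp Require Export mpoly.

Set Implicit Arguments.
Unset Strict Implicit.
Unset Printing Implicit Defensive.

Import Order.TTheory GRing.Theory Num.Theory.
Local Open Scope ring_scope.

(* For [R : realType], [R[i]] is the field of complex numbers, and            *)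
(* [Sring R] is the graded ring C[x, y, z].                                   *)
Notation Sring R := {mpoly (complex (Real.sort R))[3]}.

Section PlaneCurves.
Variable R : realType.
Local Notation C := (complex R).
Local Notation S := (Sring R).

(* Points of P^2 and lines of P^2 are both given by nonzero vectors of C^3.   *)
Definition nonzero_vec (p : 'I_3 -> C) : Prop := exists i, p i != 0.

Definition line_form (a : 'I_3 -> C) : S := \sum_(i < 3) a i *: 'X_i.

(* [homogz k p] : p \in S_k, with S_k = 0 for k < 0. *)
Definition homogz (k : int) (p : S) : Prop :=
  match k with Posz n => p \is n.-homog | Negz _ => p = 0 end.

Definition squarefree (f : S) : Prop :=
  forall g h : S, f = g ^+ 2 * h -> exists c : C, g = c%:MP.

(* A graded submodule of a free module S^n (with arbitrary shifts on the      *)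
(* summands), given by its homogeneous pieces.                                *)
Definition grmod (n : nat) := int -> 'rV[S]_n -> Prop.

Definition syzygy (f : S) (rho : 'rV[S]_3) : Prop :=
  \sum_(j < 3) rho 0 j * f^`M(j) = 0.

Definition AR (f : S) : grmod 3 := fun k rho =>
  (forall j, homogz k (rho 0 j)) /\ syzygy f rho.

Definition is_mdr (f : S) (r : nat) : Prop :=
  (exists2 rho, AR f r rho & rho != 0) /\
  (forall k : nat, (k < r)%N -> forall rho, AR f k rho -> rho = 0).

Definition Delta (rho1 rho : 'rV[S]_3) : S :=
  \det (\matrix_(i < 3) [:: \row_(j < 3) 'X_j; rho1; rho]`_i).

(* The ideal B(C, rho1) : h = v(rho) iff Delta(rho) = f h. *)
Definition Bideal (f : S) (rho1 : 'rV[S]_3) (h : S) : Prop :=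
  exists2 rho, syzygy f rho & Delta rho1 rho = f * h.

Definition in_supp_Z (f : S) (rho1 : 'rV[S]_3) (p : 'I_3 -> C) : Prop :=
  nonzero_vec p /\ forall h, Bideal f rho1 h -> h.@[p] = 0.

Definition line_avoids_Z (f : S) (rho1 : 'rV[S]_3) (a : 'I_3 -> C) : Prop :=
  forall p, in_supp_Z f rho1 p -> (line_form a).@[p] != 0.

(* The graded module S, and the graded module S(-d1) (+) S(-d2). *)
Definition grS : grmod 1 := fun k v => forall j, homogz k (v 0 j).

Definition twist2 (d1 d2 : int) : grmod 2 := fun k v =>
  homogz (k - d1) (v 0 0) /\ homogz (k - d2) (v 0 1).

(* The graded submodule l M of M, for a linear form l. *)
Definition lmul (l : S) n (M : grmod n) : grmod n := fun k v =>
  exists2 m, M (k - 1) m & v = l *: m.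

(* Nonzero homogeneous g of positive degree; the sets D_+(g) form a basis of  *)
(* the topology of P^2, stable under intersection: D_+(g) :&: D_+(h) =        *)
(* D_+(g h).                                                                  *)
Definition basic_open (g : S) : Prop :=
  g != 0 /\ exists2 e : nat, (0 < e)%N & g \is e.-homog.

(* Sections over D_+(g) of the sheaf associated with M: the degree 0 part     *)
(* M_(g) of the localization M_g, realized inside Frac(S)^n.                  *)
Definition sect n (M : grmod n) (g : S) (s : 'rV[{fraction S}]_n) : Prop :=
  exists (i k : nat) (m : 'rV[S]_n),
    [/\ g ^+ i \is k.-homog, M k m &
        s = (tofrac (g ^+ i))^-1 *: map_mx (@tofrac S) m].

Definition sectO (g : S) (c : {fraction S}) : Prop := sect grS g (\row_(_ < 1) c).

(* The restriction of the sheaf M~ to the line L : l = 0 is the sheaf         *)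
(* (M / l M)~, with sections M_(g) / (l M)_(g) over D_+(g) :&: L. An          *)
(* isomorphism of O_L-modules M~|_L -> N~|_L is a family, indexed by the      *)
(* basic open sets, of linear bijections compatible with restrictions; the    *)
(* classes in the quotients are handled through representatives.              *)
Definition restr_iso (l : S) n (M : grmod n) m (N : grmod m)
    (phi : S -> 'rV[{fraction S}]_n -> 'rV[{fraction S}]_m) : Prop :=
  forall g, basic_open g ->
  [/\ (forall s, sect M g s -> sect N g (phi g s)),
      (forall c s t, sectO g c -> sect M g s -> sect M g t ->
         sect (lmul l N) g (phi g (c *: s + t) - (c *: phi g s + phi g t))),
      (forall s, sect M g s ->
         (sect (lmul l N) g (phi g s) <-> sect (lmul l M) g s)),
      (forall t, sect N g t ->
         exists2 s, sect M g s & sect (lmul l N) g (phi g s - t)) &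
      (forall h s, basic_open h -> sect M g s ->
         sect (lmul l N) (g * h) (phi (g * h) s - phi g s))].

(* E_C|_L is isomorphic to O_L(-d1) (+) O_L(-d2), where L : a.(x,y,z) = 0. *)
Definition splitting_type (f : S) (a : 'I_3 -> C) (d1 d2 : int) : Prop :=
  d1 <= d2 /\
  exists phi, restr_iso (line_form a) (AR f) (twist2 d1 d2) phi.

(* Splitting type along all the lines of some nonempty (principal) Zariski    *)
(* open subset of the dual plane.                                             *)
Definition generic_splitting_type (f : S) (d1 d2 : int) : Prop :=
  exists (k : nat) (G : {mpoly C[3]}),
    [/\ G \is k.-homog, G != 0 &
        forall a, nonzero_vec a -> G.@[a] != 0 -> splitting_type f a d1 d2].

End PlaneCurves.

(* Main.v *)
Require Import Defs.
From HB Require Import structures.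
From mathcomp Require Import all_boot all_order all_algebra.
From mathcomp Require Import complex.
From mathcomp Require Import reals.
From mathcomp Require Import boolp ring zify.

Set Implicit Arguments.
Unset Strict Implicit.
Unset Printing Implicit Defensive.

Import Order.TTheory GRing.Theory Num.Theory.
Local Open Scope ring_scope.

(* The pairing omega(a, b) = det((x, y, z), a, b) / f of syzygies turns rho1
   into the map v, and off the zeros of v the bundle E restricted to L is an
   extension of O_L(r - d + 1) by O_L(- r).  If d1 < d - 1 - r, a generator of
   O_L(- d1) is killed by v, hence a multiple of rho1, and d1 >= r, which
   contradicts d < 2 r.

   If 2 r - d is 1 or 2, counting dimensions in the extension gives
   d1 <= d - r, so that d1 and e1 both lie in {d - 1 - r, d - r}, and it remains
   to see that h^0(E_L(d - 1 - r)) is upper semicontinuous at L.  Choose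
   syzygies m, m' whose images h, h' under v have no common zero on L.  Then
   E_L(d - 1 - r) has a nonzero section if and only if omega(m, m') belongs to
   (h, h') on L, with coefficients of a fixed degree; the corresponding linear
   independence is an open condition on the line in a pencil. *)

(** * Factorial domains and the Gauss lemma *)

(** Reducedness enters in the division by [f]: by Euler's formula [det((x, y, z), a, b)] times each
    partial derivative of [f] is a multiple of [f], while a prime factor of [f] occurs only once and
    fails to divide one of its own derivatives. This needs unique factorization in [C[x, y, z]],
    hence the Gauss lemma. On the line everything becomes arithmetic in one variable: a section of
    [E_L(k)] is a pair of syzygies restricted to the charts [u = 1] and [v = 1]. The sheaf
    isomorphism only serves to identify [d1] with the least [k] such that [E_L(k)] has a nonzero
    section. The extension class lies in [H^1(L, O(d - 1 - 2 r))], of dimension [2 r - d]. After a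
    twist by [j] the obstruction space has dimension [2 r - d - j]. For [j = 1] and [2 r - d <= 2]
    this is at most 1, less than the dimension 2 of [H^0(L, O(1))], so some nonzero section lifts;
    this is where the values 1 and 2 come from. Semicontinuity is needed only between [L] and one
    generic line, so a pencil joining the two and determinants polynomial in its parameter are
    enough. *)

Section FactorialDomains.
Variable R : idomainType.
Implicit Types (a b c p : R) (s : seq R).

Definition rdvd a b := exists c, b = c * a.

Definition prime_elt p :=
  [/\ p != 0, p \isn't a GRing.unit &
      forall a b, rdvd p (a * b) -> rdvd p a \/ rdvd p b].

Definition prime_seq s := {in s, forall p, prime_elt p}.

(** The factors are prime elements, not merely irreducible ones, so that existence alone encodes
    unique factorization. *)
Definition factorial_domain :=
  forall a, a != 0 -> exists u s,
    [/\ u \is a GRing.unit, prime_seq s & a = u * \prod_(p <- s) p].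

Lemma rdvd_mull a b c : rdvd a b -> rdvd a (c * b).
Proof. by case=> e ->; exists (c * e); rewrite mulrA. Qed.

Lemma rdvd_mulr a b c : rdvd a b -> rdvd a (b * c).
Proof. by rewrite mulrC; apply: rdvd_mull. Qed.

Lemma rdvdD a b c : rdvd a b -> rdvd a c -> rdvd a (b + c).
Proof. by case=> x -> [y ->]; exists (x + y); rewrite mulrDl. Qed.

Lemma rdvdN a b : rdvd a b -> rdvd a (- b).
Proof. by case=> x ->; exists (- x); rewrite mulNr. Qed.

Lemma prime_dvd_prod p s u : prime_elt p -> u \is a GRing.unit ->
  rdvd p (u * \prod_(q <- s) q) -> exists2 q, q \in s & rdvd p q.
Proof.
case=> p0 pU pP uU; elim: s => [|q s IHs].
  rewrite big_nil mulr1 => -[c uE]; move: pU; rewrite -unitrN.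
  by rewrite uE unitrM in uU; case/andP: uU => _; rewrite unitrN => ->.
rewrite big_cons mulrCA => /pP[]; first by exists q; rewrite ?mem_head.
by case/IHs => x xs; exists x => //; rewrite inE xs orbT.
Qed.

Lemma prime_dvd_prime p q : prime_elt p -> prime_elt q -> rdvd p q ->
  exists2 u, u \is a GRing.unit & q = u * p.
Proof.
case=> p0 pU _ [q0 qU qP] [c qE]; exists c => //.
have : rdvd q (c * p) by exists 1; rewrite mul1r qE.
case/qP=> -[e eE]; last first.
  move: (congr1 (fun x => c * x) eE); rewrite -qE mulrA => qE2.
  have : q * (1 - c * e) = 0 by rewrite mulrBr mulr1 [q * _]mulrC -qE2 subrr.
  move/eqP; rewrite mulf_eq0 (negPf q0) /= subr_eq0 => /eqP h.
  by apply/unitrP; exists e; rewrite mulrC -h.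
have : q * (1 - e * p) = 0.
  by apply/eqP; rewrite mulrBr mulr1 subr_eq0; apply/eqP; rewrite {1}qE eE; ring.
move/eqP; rewrite mulf_eq0 (negPf q0) /= subr_eq0 => /eqP h.
by case/negP: pU; apply/unitrP; exists e; rewrite [p * e]mulrC -h.
Qed.

End FactorialDomains.

Arguments prime_elt {R}.
Arguments prime_seq {R}.

Section GaussLemma.
Variable R : idomainType.
Hypothesis ufdR : factorial_domain R.
Implicit Types (P Q F G : {poly R}) (c p : R).

Lemma polyC_dvdP c F : rdvd c%:P F <-> forall i, rdvd c F`_i.
Proof.
split=> [[G -> i]|h]; first by rewrite coefMC; exists G`_i.
have /choice[g gE] : forall i, exists x, F`_i = x * c by [].
exists (\poly_(i < size F) g i); apply/polyP => i.
rewrite coefMC coef_poly; case: ltnP => [_|iF]; first exact: gE.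
by rewrite mul0r nth_default.
Qed.

(** Induction on the sum of the sizes: [p] divides the product of the leading coefficients, hence
    one of them, and that leading term can be subtracted without affecting divisibility of the
    product. *)
Lemma prime_polyC p : prime_elt p -> prime_elt p%:P.
Proof.
case=> p0 pU pP; split; rewrite ?polyC_eq0 ?poly_unitE ?coefC ?size_polyC ?p0 //=.
move=> F G; have [n] := ubnP (size F + size G)%N.
elim: n F G => // n IHn F G; rewrite ltnS => FGn FG.
have [->|F0] := eqVneq F 0; first by left; exists 0; rewrite mul0r.
have [->|G0] := eqVneq G 0; first by right; exists 0; rewrite mul0r.
have dropl (H : {poly R}) : H != 0 ->
    (size (H - (lead_coef H)%:P * 'X^((size H).-1))%R < size H)%N.
  move=> H0; rewrite -[X in (_ < X)%N]prednK ?size_poly_gt0 // ltnS.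
  apply/leq_sizeP => j; rewrite leq_eqVlt => /orP[/eqP <-|jH].
    by rewrite coefB coefCM coefXn eqxx mulr1 subrr.
  rewrite coefB coefCM coefXn gtn_eqF // mulr0 subr0 nth_default //.
  by rewrite -[size H]prednK ?size_poly_gt0.
have dlead (H : {poly R}) : rdvd p (lead_coef H) ->
    rdvd p%:P ((lead_coef H)%:P * 'X^((size H).-1)).
  case=> c ->; exists (c%:P * 'X^((size H).-1)); rewrite polyCM; exact: mulrAC.
have := (polyC_dvdP p _).1 FG (size F + size G).-2.
have -> : (F * G)`_(size F + size G).-2 = lead_coef F * lead_coef G.
  by rewrite -lead_coefM lead_coefE size_mul.
case/pP => /dlead dl.
- have [] := IHn (F - (lead_coef F)%:P * 'X^((size F).-1)) G.
  + by apply: leq_trans FGn; rewrite ltn_add2r dropl.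
  + by rewrite mulrBl; apply: rdvdD => //; apply: rdvdN; apply: rdvd_mulr.
  + by move=> h; left; have := rdvdD h dl; rewrite subrK.
  + by right.
- have [] := IHn F (G - (lead_coef G)%:P * 'X^((size G).-1)).
  + by apply: leq_trans FGn; rewrite ltn_add2l dropl.
  + by rewrite mulrBr; apply: rdvdD => //; apply: rdvdN; apply: rdvd_mull.
  + by left.
  + by move=> h; right; have := rdvdD h dl; rewrite subrK.
Qed.

Definition primitive P := forall c G, P = c%:P * G -> c \is a GRing.unit.

(** A constant dividing a polynomial divides its leading coefficient, so it is enough to divide out
    the primes of that coefficient, one at a time; no gcd is involved. *)
Lemma content_primitive F : F != 0 ->
  exists c P, [/\ c != 0, primitive P & F = c%:P * P].
Proof.
move=> F0; have lF0 : lead_coef F != 0 by rewrite lead_coef_eq0.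
have [u [s [uU sP lE]]] := ufdR lF0.
suff [c [G [t [c0 tP tN lG FE]]]] : exists c G t, [/\ c != 0, prime_seq t,
    {in t, forall p, ~ rdvd p%:P G},
    lead_coef G = u * \prod_(p <- t) p & F = c%:P * G].
  exists c, G; split=> // e H GE.
  have e0 : e != 0.
    apply: contra_neq F0 => e0; by rewrite FE GE e0 mul0r mulr0.
  have [v [w [vU wP eE]]] := ufdR e0.
  case: w wP eE => [_ ->|q w wP eE]; first by rewrite big_nil mulr1.
  have qP : prime_elt q by apply: wP; rewrite mem_head.
  have qe : rdvd q e by exists (v * \prod_(p <- w) p); rewrite eE big_cons mulrCA mulrC.
  have qG : rdvd q%:P G.
    rewrite GE; case: qe => x ->; exists (x%:P * H); rewrite polyCM; exact: mulrAC.
  have : rdvd q (u * \prod_(p <- t) p).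
    by rewrite -lG lead_coefE; apply: (polyC_dvdP q G).1.
  case/(prime_dvd_prod qP uU) => x xt qx.
  have [y yU xE] := prime_dvd_prime qP (tP _ xt) qx.
  case: (tN _ xt); case: qG => z ->; exists (z * (y^-1)%:P).
  by rewrite xE polyCM mulrA -[z * _ * _]mulrA -polyCM mulVr // mulr1.
(* [s1] lists the primes still to be tested, [s2] those known not to divide the current quotient
   [F1]; a prime that divides [F1] moves into [c]. *)
suff H s1 : forall s2 F1 c, c != 0 -> prime_seq s1 -> prime_seq s2 ->
    {in s2, forall p, ~ rdvd p%:P F1} ->
    lead_coef F1 = u * (\prod_(p <- s1) p * \prod_(p <- s2) p) -> F = c%:P * F1 ->
    exists c G t, [/\ c != 0, prime_seq t,
    {in t, forall p, ~ rdvd p%:P G},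
    lead_coef G = u * \prod_(p <- t) p & F = c%:P * G].
  apply: (H s [::] F 1) => //; rewrite ?oner_eq0 ?polyC1 ?mul1r //.
  by rewrite big_nil mulr1.
elim: s1 => [|q s1 IH] s2 F1 c c0 s1P s2P s2N lF1 FE.
  by exists c, F1, s2; split=> //; rewrite lF1 big_nil mul1r.
have s1P' : prime_seq s1 by move=> x xs; apply: s1P; rewrite inE xs orbT.
have [q0 _ _] : prime_elt q by apply: s1P; rewrite mem_head.
case: (pselect (rdvd q%:P F1)) => [[G GE]|nqF].
  apply: (IH s2 G (c * q)) => //; rewrite ?mulf_neq0 //.
  - by move=> x xs [y yE]; apply: (s2N x xs); exists (y * q%:P); rewrite GE yE mulrAC.
  - by apply: (mulIf q0); move: lF1; rewrite GE lead_coefM lead_coefC big_cons => ->; ring.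
  - by rewrite FE GE polyCM -mulrA [q%:P * _]mulrC.
apply: (IH (q :: s2) F1 c) => //.
- by move=> x; rewrite inE => /predU1P[->|/s2P//]; apply: s1P; rewrite mem_head.
- by move=> x; rewrite inE => /predU1P[->|/s2N].
- by rewrite lF1 !big_cons; congr (_ * _); rewrite mulrCA mulrA.
Qed.


(** Each prime of [c] stays prime in [{poly R}], so it divides [Q] or [F] and is cancelled there;
    [c1] and [c2] record what each factor has lost. *)
Lemma strip_const P Q F c : c != 0 -> c%:P * P = Q * F ->
  exists Q1 F1 c1 c2,
    [/\ P = Q1 * F1, Q = c1%:P * Q1, F = c2%:P * F1, c1 != 0 & c2 != 0].
Proof.
move=> c0; have [u [s [uU sP ->]]] := ufdR c0.
elim: s sP Q F => [|p s IH] sP Q F.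
  rewrite big_nil mulr1 => E.
  exists ((u^-1)%:P * Q), F, u, 1; rewrite oner_eq0 polyC1 mul1r mulrA -polyCM.
  rewrite mulrV // mul1r -mulrA -E mulrA -polyCM mulVr // mul1r; split=> //.
  by apply: contraTneq uU => ->; rewrite unitr0.
have sP' : prime_seq s by move=> x xs; apply: sP; rewrite inE xs orbT.
have pP : prime_elt p by apply: sP; rewrite mem_head.
have [p0 _ _] := pP.
have pC0 : p%:P != 0 by rewrite polyC_eq0.
rewrite big_cons => E.
have : rdvd p%:P (Q * F).
  by exists ((u * \prod_(j <- s) j)%:P * P); rewrite -E mulrCA polyCM; ring.
have [_ _ pP'] := prime_polyC pP; case/pP' => -[G GE].
- have [] := IH sP' G F.
    apply: (mulIf pC0); transitivity (Q * F); first by rewrite -E !polyCM; ring.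
    by rewrite GE; ring.
  move=> Q1 [F1 [c1 [c2 [-> GE1 -> c10 c20]]]]; exists Q1, F1, (c1 * p), c2.
  by split; rewrite ?mulf_neq0 // GE GE1 polyCM mulrAC.
- have [] := IH sP' Q G.
    apply: (mulIf pC0); transitivity (Q * F); first by rewrite -E !polyCM; ring.
    by rewrite GE; ring.
  move=> Q1 [F1 [c1 [c2 [-> -> GE1 c10 c20]]]]; exists Q1, F1, c1, (c2 * p).
  by split; rewrite ?mulf_neq0 // GE GE1 polyCM mulrAC.
Qed.

Lemma primitive_cancel P G Q c : primitive P -> c != 0 -> c%:P * G = Q * P -> rdvd P G.
Proof.
move=> pP c0 /(strip_const c0)[Q1 [P1 [c1 [c2 [-> _ PE _ _]]]]].
have c2U := pP _ _ PE; exists (Q1 * (c2^-1)%:P).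
by rewrite PE -mulrA [_%:P * (_ * _)]mulrA -polyCM mulVr // mul1r.
Qed.

(* A primitive polynomial without factorization into polynomials of smaller
   degree is prime: a nonzero element of minimal degree of the ideal [(P, G)]
   is a constant multiple either of [P] or of [1]. *)
Lemma prime_primitive P : (1 < size P)%N -> primitive P ->
    (forall A B, P = A * B -> size A = size P \/ size B = size P) ->
  prime_elt P.
Proof.
move=> sP pP irrP; have P0 : P != 0 by rewrite -size_poly_gt0 ltnW.
split=> //; first by rewrite poly_unitE gtn_eqF.
move=> G H [K KE].
pose I D := exists A B, D = A * P + B * G.
have [D [[A [B DE]] D0 Dmin]] : exists D, [/\ I D, D != 0 &
    forall E, I E -> E != 0 -> (size D <= size E)%N].
  have : exists n, `[< exists D, [/\ I D, D != 0 & size D = n] >].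
    exists (size P); apply/asboolP; exists P; split=> //.
    by exists 1, 0; rewrite mul1r mul0r addr0.
  move/ex_minnP => -[n /asboolP[D [ID D0 Dn]] nmin]; exists D; split=> // E IE E0.
  by rewrite Dn; apply: nmin; apply/asboolP; exists E.
(* Pseudo-division: the remainder lies in the ideal and is smaller than [D], hence zero. *)
have divD E : I E -> exists2 c, c != 0 & exists Q, c%:P * E = Q * D.
  case=> A' [B' EE]; exists (lead_coef D ^+ scalp E D).
    by rewrite expf_neq0 // lead_coef_eq0.
  exists (E %/ D); rewrite mul_polyC Pdiv.Idomain.divp_eq.
  suff -> : E %% D = 0 by rewrite addr0.
  apply/eqP; apply: contraT => r0.
  have IE : I (E %% D); last first.
    by have := Dmin _ IE r0; rewrite leqNgt ltn_modp D0.
  exists ((lead_coef D ^+ scalp E D)%:P * A' - E %/ D * A).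
  exists ((lead_coef D ^+ scalp E D)%:P * B' - E %/ D * B).
  have := Pdiv.Idomain.divp_eq E D; rewrite -mul_polyC.
  move/esym/(canRL (addKr _)) => ->; rewrite DE EE; ring.
have [c c0 [Q PQ]] : exists2 c, c != 0 & exists Q, c%:P * P = Q * D.
  by apply: divD; exists 1, 0; rewrite mul1r mul0r addr0.
have [e e0 [Q' GQ]] : exists2 c, c != 0 & exists Q, c%:P * G = Q * D.
  by apply: divD; exists 0, 1; rewrite mul1r mul0r add0r.
have [Q1 [D1 [c1 [c2 [PE QE DE1 c10 c20]]]]] := strip_const c0 PQ.
have := P0; rewrite {1}PE mulf_eq0 negb_or => /andP[Q0 D10].
have sQD := size_mul Q0 D10; rewrite -PE in sQD.
move: Q0 D10; rewrite -!size_poly_gt0 => Q0 D10.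
case: (irrP _ _ PE) => sz; last first.
  left; have : size Q1 = 1%N by lia.
  move/eqP/size_poly1P => [q q0 q1E].
  have qU : q \is a GRing.unit by apply: (pP q D1); rewrite PE q1E.
  apply: (@primitive_cancel _ _ (Q' * c2%:P * (q^-1)%:P) e) => //.
  rewrite GQ DE1 PE q1E -!mulrA; congr (_ * (_ * _)).
  by rewrite mulrA -polyCM mulVr // mul1r.
right; have : size D1 = 1%N by lia.
move/eqP/size_poly1P => [q q0 q1E].
apply: (@primitive_cancel _ _ (A * H + B * K) (c2 * q)); rewrite ?mulf_neq0 //.
rewrite polyCM -q1E -DE1 DE mulrDl [B * G * H]mulrAC -mulrA.
rewrite [B * H * G]mulrAC -mulrA KE; ring.
Qed.

Theorem factorial_poly : factorial_domain {poly R}.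
Proof.
move=> F; have [n] := ubnP (size F); elim: n F => // n IH F; rewrite ltnS => Fn F0.
have [c [P [c0 pP FE]]] := content_primitive F0.
have P0 : P != 0 by apply: contra_neq F0 => P0; rewrite FE P0 mulr0.
have [u [s [uU sP cE]]] := ufdR c0.
suff [v [t [vU tP PE]]] : exists v t, [/\ v \is a GRing.unit, prime_seq t
    & P = v * \prod_(p <- t) p].
  exists (u%:P * v), ([seq p%:P | p <- s] ++ t); split.
  - by rewrite unitrM vU andbT rmorph_unit.
  - move=> x; rewrite mem_cat => /orP[/mapP[p ps ->]|/tP//].
    exact: prime_polyC (sP _ ps).
  - rewrite big_cat big_map /= FE cE PE polyCM rmorph_prod /=; ring.
have szP : size P = size F by rewrite FE size_Cmul.
case: (ltnP 1 (size P)) => [sP1|]; last first.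
  rewrite leq_eqVlt ltnS leqn0 size_poly_eq0 (negPf P0) orbF.
  case/size_poly1P => q q0 PE; exists P, [::]; rewrite big_nil mulr1; split=> //.
  have qU : q \is a GRing.unit by apply: (pP q 1); rewrite mulr1.
  by rewrite PE poly_unitE coefC size_polyC q0 qU.
case: (pselect (forall A B, P = A * B -> size A = size P \/ size B = size P)).
  move=> irrP; exists 1, [:: P]; rewrite unitr1 big_seq1 mul1r; split=> // x.
  by rewrite inE => /eqP ->; exact: prime_primitive.
move=> /existsNP[A /existsNP[B /not_implyP[PE /not_orP[/eqP sA /eqP sB]]]].
have : P != 0 := P0; rewrite {1}PE mulf_eq0 negb_or => /andP[A0 B0].
have sAB := size_mul A0 B0; rewrite -PE in sAB.
have A1 : (0 < size A)%N by rewrite size_poly_gt0.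
have B1 : (0 < size B)%N by rewrite size_poly_gt0.
have [||a [s1 [aU s1P AE]]] := IH A; rewrite -?szP in Fn *; [lia|by []|].
have [||b [s2 [bU s2P BE]]] := IH B; [lia|by []|].
exists (a * b), (s1 ++ s2); rewrite unitrM aU bU; split=> //.
  by move=> x; rewrite mem_cat => /orP[/s1P|/s2P].
by rewrite big_cat PE AE BE /=; ring.
Qed.

End GaussLemma.

Lemma factorial_bij (R R' : idomainType) (g : {rmorphism R -> R'}) :
  bijective g -> factorial_domain R -> factorial_domain R'.
Proof.
case=> h gK hK ufd a a0.
have gU x : (g x \is a GRing.unit) = (x \is a GRing.unit).
  apply/idP/idP; last exact: rmorph_unit.
  case/unitrP => y [y1 y2]; apply/unitrP; exists (h y).
  by split; apply: (can_inj gK); rewrite rmorphM rmorph1 hK.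
have gdvd x y : rdvd x y <-> rdvd (g x) (g y).
  split=> -[z zE]; first by exists (g z); rewrite zE rmorphM.
  by exists (h z); apply: (can_inj gK); rewrite zE rmorphM hK.
have ha0 : h a != 0 by apply: contra_neq a0 => h0; rewrite -(hK a) h0 rmorph0.
have [u [s [uU sP aE]]] := ufd _ ha0; exists (g u), [seq g p | p <- s]; split.
- by rewrite gU.
- move=> x /mapP[p /sP[p0 pU pP] ->]; split; rewrite ?gU //.
    by apply: contra_neq p0 => p0; apply: (can_inj gK); rewrite p0 rmorph0.
  by move=> b c; rewrite -(hK b) -(hK c) -rmorphM -!gdvd; apply: pP.
- by rewrite big_map -rmorph_prod -rmorphM -aE hK.
Qed.

Lemma factorial_field (F : fieldType) : factorial_domain F.
Proof.
by move=> a a0; exists a, [::]; rewrite unitfE a0 big_nil mulr1.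
Qed.

(** * Unique factorization in several variables *)

Section MpolyFactorial.
Variable (F : fieldType).

Lemma muniX n (m : 'X_{1..n.+1}) :
  muni ('X_[m] : {mpoly F[n.+1]}) =
  ('X_[[multinom (m (widen_ord (leqnSn n) i)) | i < n]])%:P * 'X^(m ord_max).
Proof.
by rewrite muniE msuppX big_seq1 mcoeffX eqxx scale1r mul_polyC.
Qed.

(** The inverse of [muni], along which factoriality is carried from [{poly {mpoly F[n]}}] to [{mpoly
    F[n.+1]}]. *)
Definition of_muni n (p : {poly {mpoly F[n]}}) : {mpoly F[n.+1]} :=
  horner_eval ('X_ord_max) (mpwiden p).

Lemma of_muni_additive n : {morph @of_muni n : p q / p - q}.
Proof. by move=> p q; rewrite /of_muni !raddfB. Qed.

Lemma of_muni_mul n : {morph @of_muni n : p q / p * q}.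
Proof. by move=> p q; rewrite /of_muni !rmorphM. Qed.

Lemma of_muni1 n : @of_muni n 1 = 1.
Proof. by rewrite /of_muni !rmorph1. Qed.

HB.instance Definition _ n :=
  GRing.isAdditive.Build {poly {mpoly F[n]}} {mpoly F[n.+1]} (@of_muni n)
    (@of_muni_additive n).
HB.instance Definition _ n :=
  GRing.isMultiplicative.Build {poly {mpoly F[n]}} {mpoly F[n.+1]} (@of_muni n)
    (conj (@of_muni_mul n) (@of_muni1 n)).

Lemma of_muniM n (c : {mpoly F[n]}) k : of_muni (c%:P * 'X^k) = mwiden c * 'X_ord_max ^+ k.
Proof.
by rewrite of_muni_mul rmorphXn /= /of_muni mpwidenC mpwidenX /horner_eval hornerC hornerX.
Qed.


Lemma of_muniX n (m : 'X_{1..n.+1}) : of_muni (muni 'X_[m]) = 'X_[m].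
Proof.
rewrite muniX of_muniM mwidenX mpolyXn -mpolyXD; congr 'X_[_].
apply/mnmP => i; rewrite mnmDE mulmnE mnm1E.
case: (unliftP ord_max i) => [j ->|->].
  rewrite (_ : lift ord_max j = widen_ord (leqnSn n) j); last first.
    by apply: val_inj; rewrite /= /bump leqNgt ltn_ord.
  rewrite mnmwiden_widen mnmE (_ : (ord_max == _) = false) ?addn0 //.
  by apply: gtn_eqF => /=.
by rewrite mnmwiden_ordmax eqxx mul1n.
Qed.

Lemma muniK n : cancel (@muni n F) (@of_muni n).
Proof.
move=> p; rewrite {1}(mpolyE p) (raddf_sum (@muni n F)) (raddf_sum (@of_muni n)).
rewrite [RHS]mpolyE; apply: eq_bigr => m _.
rewrite /= -mul_mpolyC muniM of_muni_mul muniC; congr (_ * _); last exact: of_muniX.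
by rewrite -[_%:P]mulr1 -(expr0 'X) of_muniM mwidenC expr0 mulr1.
Qed.

Lemma of_muniK n : cancel (@of_muni n) (@muni n F).
Proof.
move=> p; rewrite -[p]coefK poly_def (raddf_sum (@of_muni n)) (raddf_sum (@muni n F)).
apply: eq_bigr => i _.
rewrite /= -mul_polyC of_muniM muniM (rmorphXn (@muni n F)) /= muniX.
set X := (X in X ^+ i); have -> : X = 'X.
  rewrite /X mnm1E eqxx expr1 (_ : [multinom _ | _ < _] = 0%MM) ?mpolyX0 ?mul1r //.
  apply/mnmP => j; rewrite mnmE mnm0E mnm1E; apply/eqP; rewrite eqb0.
  by rewrite -val_eqE /= gtn_eqF.
congr (_ * _); rewrite [in RHS](mpolyE p`_i) {1}(mpolyE p`_i).
rewrite (raddf_sum (@mwiden n F)) (raddf_sum (@muni n F)).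
rewrite (raddf_sum (@polyC _)); apply: eq_bigr => m _.
rewrite /= -!mul_mpolyC mwidenM muniM polyCM mwidenC muniC
   mwidenX muniX mnmwiden_ordmax expr0 mulr1.
by congr (_ * _%:P); congr 'X_[_]; apply/mnmP => j; rewrite mnmE mnmwiden_widen.
Qed.

Theorem factorial_mpoly n : factorial_domain {mpoly F[n]}.
Proof.
elim: n => [|n IH].
  have bij : bijective (@mpolyC 0 F).
    by exists (mcoeff 0%MM); [exact: mpolyCK | exact: mpolyKC].
  exact: (@factorial_bij F {mpoly F[0]} (@mpolyC 0 F) bij (@factorial_field F)).
have bij : bijective (@of_muni n).
  by exists (@muni n F); [exact: of_muniK | exact: muniK].
pose g : {rmorphism {poly {mpoly F[n]}} -> {mpoly F[n.+1]}} := @of_muni n.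
have := @factorial_bij {poly {mpoly F[n]}} {mpoly F[n.+1]} g.
move/(_ bij).
move/(_ (factorial_poly IH)).
by [].
Qed.
End MpolyFactorial.

(** * Homogeneous polynomials *)

Section HomogeneousPolynomials.
Variables (n : nat) (F : numFieldType).
Implicit Types (p q f : {mpoly F[n]}).

Lemma mderiv_supp j p m : m \in msupp p^`M(j) -> (m + U_(j))%MM \in msupp p.
Proof.
rewrite !mcoeff_msupp mcoeff_deriv; apply: contraNN => /eqP ->.
by rewrite mul0rn.
Qed.

Lemma msize_mderiv j p : p != 0 -> (msize p^`M(j) < msize p)%N.
Proof.
move=> p0; have p1 : (0 < msize p)%N by rewrite lt0n msize_poly_eq0.
rewrite -[X in (_ < X)%N]prednK // ltnS msizeE; apply/bigmax_leqP_seq => m mp _.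
have := msize_mdeg_lt (mderiv_supp mp); rewrite mdegD mdeg1; lia.
Qed.

Lemma mderiv_eq0_const p : (forall j, p^`M(j) = 0) -> p = (p@_0)%:MP.
Proof.
move=> h; apply/mpolyP => m; rewrite mcoeffC.
case: (eqVneq m 0%MM) => [->|m0]; first by rewrite mulr1.
rewrite mulr0; have /existsP[i mi] : [exists i, m i != 0%N].
  apply: contraNT m0; rewrite negb_exists => /forallP mz.
  by apply/eqP/mnmP => i; rewrite mnm0E; apply/eqP; rewrite -[_ == _]negbK.
have := congr1 (mcoeff (m - U_(i))%MM) (h i).
rewrite mcoeff_deriv mcoeff0 submK ?lep1mP // => /eqP.
by rewrite mulrn_eq0 /= => /eqP.
Qed.

(** A derivative has smaller size than [p], so it is divisible by [p] only if it is zero; in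
    characteristic 0 all derivatives vanish only for constants, which are no primes. *)
Lemma prime_ndvd_mderiv p : prime_elt p -> exists j, ~ rdvd p p^`M(j).
Proof.
case=> p0 pU _; apply/not_existsP => h; case/negP: pU.
have pj j : p^`M(j) = 0.
  apply: contrapT => /eqP pj0; have [q qE] : rdvd p p^`M(j) by apply: contrapT => /h.
  have := msize_mderiv j p0; rewrite qE msizeM //; last first.
    by apply: contraNneq pj0 => q0; rewrite qE q0 mul0r.
  have : (0 < msize q)%N.
    by rewrite lt0n msize_poly_eq0; apply: contraNneq pj0 => q0; rewrite qE q0 mul0r.
  by move: (msize q) (msize p) => a b; lia.
have pE := mderiv_eq0_const pj; rewrite pE rmorph_unit // unitfE.
by apply: contraNneq p0 => c0; rewrite pE c0.
Qed.

(** The prime factors of [f] are split off from [D] one by one; each occurs once in [f] and does not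
    divide one of its own derivatives. *)
Lemma squarefree_dvd f (D : {mpoly F[n]}) :
  f != 0 -> (forall g h, f = g ^+ 2 * h -> exists c, g = c%:MP) ->
  (forall j, rdvd f (D * f^`M(j))) -> rdvd f D.
Proof.
move=> f0 sqf fD; have [u [s [uU sP fE]]] := factorial_mpoly f0.
suff H t t' : s = t ++ t' -> rdvd (\prod_(p <- t) p) D.
  have [c ->] := H s [::] (esym (cats0 s)).
  by exists (c * u^-1); rewrite fE mulrA mulrVK.
elim/last_ind: t t' => [|t p IH] t' sE.
  by rewrite big_nil; exists D; rewrite mulr1.
rewrite cat_rcons in sE; have [D1 D1E] := IH _ sE.
move: fE; rewrite sE big_cat big_cons /=.
set A := \prod_(j <- t) j in D1E *; set B := \prod_(j <- t') j => fE.
have pP : prime_elt p by apply: sP; rewrite sE mem_cat mem_head orbT.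
have [p0 pU pP2] := pP.
have A0 : A != 0.
  by apply: contraNneq f0 => A0; rewrite fE A0 mul0r mulr0.
have pW : ~ rdvd p (u * (A * B)).
  case=> q qE; have [c pc] : exists c, p = c%:MP.
    by apply: (sqf _ q); transitivity (p * (u * (A * B))); [rewrite fE | rewrite qE]; ring.
  case/negP: pU; rewrite pc rmorph_unit // unitfE.
  by apply: contraNneq p0 => c0; rewrite pc c0.
have [j pj] := prime_ndvd_mderiv pP.
(* With [f = p W], Leibniz writes [D f_j] as [D p_j W] plus a multiple of [p W_j]; the part [A]
   already split off from [D] is then cancelled. *)
have : rdvd p (D1 * (p^`M(j) * (u * (A * B)))).
  have [E EE] := fD j.
  exists (u * B * E - D1 * (u * (A * B))^`M(j)); apply: (mulIf A0).
  have fpW : f = p * (u * (A * B)) by rewrite fE; ring.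
  move: EE; rewrite D1E {1}fpW mderivM => EE.
  transitivity (E * f - D1 * A * (p * (u * (A * B))^`M(j))).
    by rewrite -EE; ring.
  by rewrite fpW; ring.
case/pP2 => [[D2 D2E]|/pP2[]] //.
exists D2; rewrite -cats1 big_cat big_seq1 -/A D1E D2E /= -/A; ring.
Qed.

(** Used to pass homogeneity from a product to its second factor, in particular to the quotient of a
    determinant by [f]. *)
Lemma pihomogMl d e f q : f \is d.-homog ->
  pihomog mdeg (d + e) (f * q) = f * pihomog mdeg e q.
Proof.
move=> fd; rewrite {1}(pihomog_partitionE (leqnn (msize q))) mulr_sumr raddf_sum.
have fk k : f * pihomog mdeg k q \is (d + k).-homog by rewrite dhomogM // pihomogP.
have fne k : k != e -> pihomog mdeg (d + e) (f * pihomog mdeg k q) = 0.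
  by move=> ke; apply: (pihomog_ne0 _ (fk k)); rewrite eqn_add2l.
case: (ltnP e (msize q)) => eq.
  rewrite (bigD1 (Ordinal eq)) //= pihomog_dE ?fk // big1 ?addr0 // => k ke.
  by apply: fne; rewrite -val_eqE /= in ke.
rewrite big1 => [|k _]; last by apply: fne; rewrite ltn_eqF // (leq_trans (ltn_ord k)).
rewrite pihomogE big_seq_cond big1 ?mulr0 // => m /andP[mq /eqP me].
by have := msize_mdeg_lt mq; rewrite me ltnNge eq.
Qed.

Lemma dhomog_divl d k f q : f != 0 -> f \is d.-homog -> f * q \is (d + k).-homog ->
  q \is k.-homog.
Proof.
move=> f0 fd fq; have := pihomogMl k q fd.
by rewrite pihomog_dE // => /(mulfI f0) ->; apply: pihomogP.
Qed.

Lemma dhomog_divl_lt d k f q : f != 0 -> f \is d.-homog -> f * q \is k.-homog ->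
  (k < d)%N -> q = 0.
Proof.
move=> f0 fd fq kd; rewrite (pihomog_partitionE (leqnn (msize q))) big1 // => e _.
apply: (mulfI f0); rewrite mulr0 -(pihomogMl e q fd).
by apply: pihomog_ne0 fq; rewrite ltn_eqF // (leq_trans kd) ?leq_addr.
Qed.

Lemma dhomog_mderiv d f j : f \is d.+1.-homog -> f^`M(j) \is d.-homog.
Proof.
move/dhomogP => fd; apply/dhomogP => m /mderiv_supp/fd /=.
by rewrite mdegD mdeg1; lia.
Qed.

Lemma euler d f : f \is d.-homog -> \sum_j 'X_j * f^`M(j) = f *+ d.
Proof.
move/dhomogP => fd; under eq_bigr do rewrite {1}(mpolyE f) raddf_sum mulr_sumr.
rewrite exchange_big /= {3}(mpolyE f) -sumrMnl; apply: eq_big_seq => m mf.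
rewrite -(fd m mf) /= mdegE -sumrMnr; apply: eq_bigr => j _.
rewrite mderivZ mderivX scalerA -scalerAr -mpolyXD.
case: (eqVneq (m j) 0%N) => [->|mj]; first by rewrite mulr0 scale0r mulr0n.
by rewrite addmC submK ?lep1mP // mulr_natr -scalerMnl.
Qed.

Lemma mevalZ_homog d f (c : F) (x : 'I_n -> F) : f \is d.-homog ->
  f.@[fun i => c * x i] = c ^+ d * f.@[x].
Proof.
move/dhomogP => fd; rewrite !mevalE mulr_sumr; apply: eq_big_seq => m mf.
rewrite mulrCA; congr (_ * _); rewrite -(fd m mf) /= mdegE -prodrXr -big_split /=.
by apply: eq_bigr => i _; rewrite exprMn.
Qed.

End HomogeneousPolynomials.

(** * Syzygies *)

Local Notation i0 := (ord0 : 'I_3).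
Local Notation i1 := (lift ord0 ord0 : 'I_3).
Local Notation i2 := (lift ord0 (lift ord0 ord0) : 'I_3).


Section ThreeVectors.
Variable K : comNzRingType.
Implicit Types (x y z w g : 'I_3 -> K).

Lemma sum3 (V : nmodType) (G : 'I_3 -> V) : \sum_(j < 3) G j = G i0 + G i1 + G i2.
Proof. by rewrite !big_ord_recl big_ord0 addr0 addrA. Qed.

Lemma ord3P (P : 'I_3 -> Prop) : P i0 -> P i1 -> P i2 -> forall j, P j.
Proof.
move=> p0 p1 p2 j.
by case: (unliftP i0 j) => [k ->|->//]; case: (unliftP ord0 k) => [l ->|->//]; rewrite (ord1 l).
Qed.

Definition det3 x y z :=
  x i0 * (y i1 * z i2 - y i2 * z i1) + x i1 * (y i2 * z i0 - y i0 * z i2) +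
  x i2 * (y i0 * z i1 - y i1 * z i0).

Lemma det3E (M : 'M[K]_3) : \det M = det3 (M i0) (M i1) (M i2).
Proof.
rewrite /det3 (expand_det_row _ i0) sum3 /cofactor.
rewrite !(expand_det_row _ ord0) !big_ord_recl !big_ord0 /cofactor !det_mx11 !mxE.
have e1 : lift i1 (ord0 : 'I_2) = i0 by apply: val_inj.
have e2 : lift i1 (lift ord0 ord0 : 'I_2) = i2 by apply: val_inj.
have e3 : lift i2 (ord0 : 'I_2) = i0 by apply: val_inj.
have e4 : lift i2 (lift ord0 ord0 : 'I_2) = i1 by apply: val_inj.
have e5 : lift (lift ord0 ord0) (ord0 : 'I_1) = ord0 :> 'I_2 by apply: val_inj.
have e6 : (0 : 'I_1) = ord0 by apply: val_inj.
rewrite !e6 !e5 !e1 !e2 !e3 !e4 /= /bump /= !addn0 !expr0 !expr1 -signr_odd /=.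
ring.
Qed.


Lemma det3C w x y : det3 w x y = - det3 w y x.
Proof. by rewrite /det3; ring. Qed.

Lemma det3xx w x : det3 w x x = 0.
Proof. by rewrite /det3; ring. Qed.

Lemma det3D w x y z : det3 w x (fun j => y j + z j) = det3 w x y + det3 w x z.
Proof. by rewrite /det3; ring. Qed.

Lemma det3Z w x y p : det3 w x (fun j => p * y j) = p * det3 w x y.
Proof. by rewrite /det3; ring. Qed.

Lemma det3_orthogonal x y z g : \sum_j x j * g j = 0 -> \sum_j y j * g j = 0 ->
  \sum_j z j * g j = 0 -> forall j, det3 x y z * g j = 0.
Proof.
rewrite !sum3 /det3; move: (x i0) (x i1) (x i2) (y i0) (y i1) (y i2).
move: (z i0) (z i1) (z i2) => z0 z1 z2 x0 x1 x2 y0 y1 y2.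
move=> hx hy hz; apply: ord3P; move: hx hy hz; move: (g i0) (g i1) (g i2) => g0 g1 g2 hx hy hz.
- transitivity ((x0 * g0 + x1 * g1 + x2 * g2) * (y1 * z2 - y2 * z1)
    + (y0 * g0 + y1 * g1 + y2 * g2) * (z1 * x2 - z2 * x1)
    + (z0 * g0 + z1 * g1 + z2 * g2) * (x1 * y2 - x2 * y1)); first by ring.
  by rewrite hx hy hz !mul0r !addr0.
- transitivity ((x0 * g0 + x1 * g1 + x2 * g2) * (y2 * z0 - y0 * z2)
    + (y0 * g0 + y1 * g1 + y2 * g2) * (z2 * x0 - z0 * x2)
    + (z0 * g0 + z1 * g1 + z2 * g2) * (x2 * y0 - x0 * y2)); first by ring.
  by rewrite hx hy hz !mul0r !addr0.
- transitivity ((x0 * g0 + x1 * g1 + x2 * g2) * (y0 * z1 - y1 * z0)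
    + (y0 * g0 + y1 * g1 + y2 * g2) * (z0 * x1 - z1 * x0)
    + (z0 * g0 + z1 * g1 + z2 * g2) * (x0 * y1 - x1 * y0)); first by ring.
  by rewrite hx hy hz !mul0r !addr0.
Qed.

Lemma det3_cramer w x y z j :
  det3 w y z * x j - det3 w x z * y j + det3 w x y * z j = det3 x y z * w j.
Proof. by move: j; apply: ord3P; rewrite /det3; ring. Qed.

(* If [x] and [y] are orthogonal to [g] then [det3 w x y * g = (w . g) (x * y)]. *)
Lemma det3_cross w x y g : \sum_j x j * g j = 0 -> \sum_j y j * g j = 0 ->
  forall j, exists e, det3 w x y * g j = e * \sum_j w j * g j.
Proof.
rewrite !sum3 /det3; move: (x i0) (x i1) (x i2) (y i0) (y i1) (y i2).
move: (w i0) (w i1) (w i2) => X0 X1 X2 x0 x1 x2 y0 y1 y2.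
move=> ha hb; apply: ord3P; move: ha hb; move: (g i0) (g i1) (g i2) => g0 g1 g2 ha hb.
- exists (x1 * y2 - x2 * y1); apply/eqP; rewrite -subr_eq0; apply/eqP.
  transitivity ((x0 * g0 + x1 * g1 + x2 * g2) * (y1 * X2 - y2 * X1)
    - (y0 * g0 + y1 * g1 + y2 * g2) * (x1 * X2 - x2 * X1)); first by ring.
  by rewrite ha hb !mul0r subr0.
- exists (x2 * y0 - x0 * y2); apply/eqP; rewrite -subr_eq0; apply/eqP.
  transitivity ((x0 * g0 + x1 * g1 + x2 * g2) * (y2 * X0 - y0 * X2)
    - (y0 * g0 + y1 * g1 + y2 * g2) * (x2 * X0 - x0 * X2)); first by ring.
  by rewrite ha hb !mul0r subr0.
- exists (x0 * y1 - x1 * y0); apply/eqP; rewrite -subr_eq0; apply/eqP.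
  transitivity ((x0 * g0 + x1 * g1 + x2 * g2) * (y0 * X1 - y1 * X0)
    - (y0 * g0 + y1 * g1 + y2 * g2) * (x0 * X1 - x1 * X0)); first by ring.
  by rewrite ha hb !mul0r subr0.
Qed.

End ThreeVectors.

(** * The alternating pairing of syzygies *)

Section Syzygies.
Variable F : numFieldType.
Local Notation S := {mpoly F[3]}.
Implicit Types (a b c : 'rV[S]_3).

Definition syz (f : S) a := \sum_(j < 3) a 0 j * f^`M(j) = 0.

Definition det_euler a b : S := det3 (fun j => 'X_j) (a 0) (b 0).

Definition homv n a := forall j, a 0 j \is n.-homog.

Variables (f : S) (d : nat).

Lemma syzD a b : syz f a -> syz f b -> syz f (a + b).
Proof.
rewrite /syz => ha hb; under eq_bigr do rewrite mxE mulrDl.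
by rewrite big_split /= ha hb addr0.
Qed.

Lemma syzZE p a : \sum_(j < 3) (p *: a) 0 j * f^`M(j) = p * \sum_(j < 3) a 0 j * f^`M(j).
Proof. by under eq_bigr do rewrite mxE -mulrA; rewrite mulr_sumr. Qed.

Lemma syzZ p a : syz f a -> syz f (p *: a).
Proof. by rewrite /syz syzZE => ->; rewrite mulr0. Qed.

Lemma syzN a : syz f a -> syz f (- a).
Proof. by move=> /(syzZ (-1)); rewrite scaleN1r. Qed.

Lemma syzZI p a : p != 0 -> syz f (p *: a) -> syz f a.
Proof. by rewrite /syz syzZE => p0 h; apply: (mulfI p0); rewrite mulr0. Qed.

Lemma homvD n a b : homv n a -> homv n b -> homv n (a + b).
Proof. by move=> ha hb j; rewrite mxE rpredD. Qed.

Lemma homvN n a : homv n a -> homv n (- a).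
Proof. by move=> ha j; rewrite mxE rpredN. Qed.

Lemma homvZ m n p a : p \is m.-homog -> homv n a -> homv (m + n) (p *: a).
Proof. by move=> hp ha j; rewrite mxE dhomogM. Qed.

Hypotheses (d_gt0 : (0 < d)%N) (f_homog : f \is d.-homog) (f_neq0 : f != 0).

Lemma grad_neq0 : exists j, f^`M(j) != 0.
Proof.
apply: contrapT => /forallNP h; have := euler f_homog.
rewrite big1 => [/esym/eqP|j _].
  by rewrite -(scaler_nat d f) scaler_eq0 pnatr_eq0 eqn0Ngt d_gt0 (negPf f_neq0).
by have /negP/negPn/eqP -> := h j; rewrite mulr0.
Qed.

(** Syzygies have rank two: three of them are orthogonal to the nonzero gradient, so their
    determinant vanishes, and Cramer's rule with the Euler vector [(x, y, z)] leaves this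
    relation. *)
Lemma det_euler_dependence a b c : syz f a -> syz f b -> syz f c ->
  det_euler b c *: a - det_euler a c *: b + det_euler a b *: c = 0.
Proof.
move=> ha hb hc; have [j fj] := grad_neq0.
have T0 : det3 (a 0) (b 0) (c 0) = 0.
  by apply: (mulIf fj); rewrite mul0r; exact: (det3_orthogonal ha hb hc).
apply/rowP => k; rewrite !mxE /det_euler -[RHS](mul0r 'X_k) -T0.
exact: (det3_cramer (fun j => 'X_j)).
Qed.

Hypothesis f_reduced : forall g h, f = g ^+ 2 * h -> exists k : F, g = k%:MP.

(** The cross product of [a] and [b] is proportional to the gradient, and pairing with the Euler
    vector turns the gradient into [d f]; hence [f] divides [det_euler a b * f_j] for every [j]. *)
Lemma dvd_det_euler a b : syz f a -> syz f b -> rdvd f (det_euler a b).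
Proof.
move=> sa sb; apply: squarefree_dvd => // j; rewrite /det_euler.
have [e ->] := det3_cross (fun j => 'X_j) sa sb j.
by exists (e * d%:R); rewrite (euler f_homog) -[f *+ d]mulr_natl mulrA.
Qed.

Lemma det_eulerC a b : det_euler a b = - det_euler b a.
Proof. by rewrite /det_euler det3C. Qed.

Lemma det_eulerDr a b c : det_euler a (b + c) = det_euler a b + det_euler a c.
Proof.
rewrite /det_euler -det3D; congr det3; apply: funext => j; exact: mxE.
Qed.

Lemma det_eulerZr p a b : det_euler a (p *: b) = p * det_euler a b.
Proof.
rewrite /det_euler -det3Z; congr det3; apply: funext => j; exact: mxE.
Qed.

(** The quotient is picked by choice, with value 0 when [f] does not divide; this is why the rules
    below carry syzygy hypotheses. For [a] equal to [rho1] this is the map [v]. *)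
Definition omega a b : S :=
  if pselect (rdvd f (det_euler a b)) is left h then projT1 (cid h) else 0.

Lemma omegaE a b : syz f a -> syz f b -> det_euler a b = f * omega a b.
Proof.
move=> sa sb; rewrite /omega; case: pselect => [h|/(_ (dvd_det_euler sa sb))//].
by rewrite mulrC; apply: (projT2 (cid h)).
Qed.

Lemma omega_eq a b w : det_euler a b = f * w -> omega a b = w.
Proof.
move=> E; rewrite /omega; case: pselect => [h|[]]; last by exists w; rewrite mulrC.
by apply: (mulfI f_neq0); rewrite -E mulrC; symmetry; apply: (projT2 (cid h)).
Qed.

Lemma omegaC a b : syz f a -> syz f b -> omega a b = - omega b a.
Proof. by move=> sa sb; apply: omega_eq; rewrite mulrN -omegaE // det_eulerC. Qed.

Lemma omegaxx a : omega a a = 0.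
Proof. by apply: omega_eq; rewrite mulr0 /det_euler det3xx. Qed.

Lemma omegaDr a b c : syz f a -> syz f b -> syz f c ->
  omega a (b + c) = omega a b + omega a c.
Proof. by move=> sa sb sc; apply: omega_eq; rewrite mulrDr -!omegaE // det_eulerDr. Qed.

Lemma omegaZr p a b : syz f a -> syz f b -> omega a (p *: b) = p * omega a b.
Proof. by move=> sa sb; apply: omega_eq; rewrite mulrCA -!omegaE // det_eulerZr. Qed.

Lemma omegaNr a b : syz f a -> syz f b -> omega a (- b) = - omega a b.
Proof. by move=> sa sb; rewrite -scaleN1r omegaZr // mulN1r. Qed.

Lemma omegaBr a b c : syz f a -> syz f b -> syz f c ->
  omega a (b - c) = omega a b - omega a c.
Proof. by move=> sa sb sc; rewrite omegaDr ?omegaNr //; apply: syzN. Qed.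

Lemma omega_dependence a b c : syz f a -> syz f b -> syz f c ->
  omega b c *: a - omega a c *: b + omega a b *: c = 0.
Proof.
move=> sa sb sc; have /rowP D := det_euler_dependence sa sb sc.
apply/rowP => j; apply: (mulfI f_neq0); move: (D j); rewrite !omegaE // !mxE => E.
by rewrite mulr0 mulrDr mulrBr !mulrA.
Qed.

(** The relation [omega_dependence] paired with a fourth syzygy. *)
Lemma omega_plucker a b c e : syz f a -> syz f b -> syz f c -> syz f e ->
  omega b c * omega e a - omega a c * omega e b + omega a b * omega e c = 0.
Proof.
move=> sa sb sc se.
have sA := syzZ (omega b c) sa; have sB := syzZ (omega a c) sb.
have sC := syzZ (omega a b) sc; have sAB := syzD sA (syzN sB).
rewrite -(omegaZr (omega b c) se sa) -(omegaZr (omega a c) se sb).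
rewrite -(omegaZr (omega a b) se sc) -(omegaBr se sA sB) -(omegaDr se sAB sC).
rewrite omega_dependence //; apply: omega_eq; rewrite mulr0.
by rewrite -(scale0r e) det_eulerZr mul0r.
Qed.

Lemma det_euler_homog m n a b : homv m a -> homv n b -> det_euler a b \is (m + n).+1.-homog.
Proof.
move=> ha hb; rewrite /det_euler /det3.
have X1 (j : 'I_3) : ('X_j : S) \is 1.-homog by rewrite dhomogX /= mdeg1.
have ab i j : a 0 i * b 0 j \is (m + n).-homog by apply: dhomogM.
rewrite -(add1n (m + n)).
by do ![apply: rpredD | apply: dhomogM => //; apply: rpredB].
Qed.

Lemma omega_homog m n k a b : syz f a -> syz f b -> homv m a -> homv n b ->
  (k + d = (m + n).+1)%N -> omega a b \is k.-homog.
Proof.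
move=> sa sb ha hb kE; have := det_euler_homog ha hb.
by rewrite omegaE // -kE addnC; apply: dhomog_divl.
Qed.

Lemma omega_homog_lt m n a b : syz f a -> syz f b -> homv m a -> homv n b ->
  ((m + n).+1 < d)%N -> omega a b = 0.
Proof.
move=> sa sb ha hb kE; have := det_euler_homog ha hb.
by rewrite omegaE // => h; apply: dhomog_divl_lt h kE.
Qed.

End Syzygies.

(** * Restriction to a line *)

Lemma homog_ind n (F : fieldType) (P : nat -> {mpoly F[n]} -> Prop) :
  (forall k, P k 0) -> (forall k g h, P k g -> P k h -> P k (g + h)) ->
  (forall k c g, P k g -> P k (c *: g)) ->
  P 0%N 1 -> (forall k j g, P k g -> P k.+1 ('X_j * g)) ->
  forall k g, g \is k.-homog -> P k g.
Proof.
move=> P0 PD PZ P1 PX k g /dhomogP gk; rewrite [g]mpolyE big_seq.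
apply: big_ind => [||m /gk /= mk]; [exact: P0 | exact: PD | apply: PZ].
elim: k m mk {gk} => [|k IH] m mk.
  by move/eqP: mk; rewrite mdeg_eq0 => /eqP ->; rewrite mpolyX0.
have /existsP[i mi] : [exists i, m i != 0%N].
  apply: contra_eqT mk; rewrite negb_exists => /forallP mz.
  by rewrite mdegE big1 // => i _; apply/eqP; have := mz i; rewrite negbK.
rewrite -(submK (_ : U_(i) <= m)%MM) ?lep1mP // addmC mpolyXD; apply: PX; apply: IH.
by move: mk; rewrite -{1}(submK (_ : U_(i) <= m)%MM) ?lep1mP // mdegD mdeg1 addn1 => -[].
Qed.

Section Restriction.
Variable F : numFieldType.
Local Notation S := {mpoly F[3]}.
Implicit Types (p q x : 'I_3 -> F) (g h u v l : S) (P : {poly F}).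

(** The point [q] is at infinity in this chart: a form of degree [k] vanishes there exactly when the
    coefficient of degree [k] is missing. *)
Definition ev p q g : {poly F} := mmap (@polyC F) (fun j => (p j)%:P + q j *: 'X) g.

HB.instance Definition _ p q := GRing.RMorphism.copy (ev p q)
  (mmap (@polyC F) (fun j => (p j)%:P + q j *: 'X)).

Lemma evX p q j : ev p q 'X_j = (p j)%:P + q j *: 'X.
Proof. by rewrite /ev mmapX mmap1U. Qed.

Lemma evC p q c : ev p q c%:MP = c%:P.
Proof. exact: mmapC. Qed.

Lemma evZ p q c g : ev p q (c *: g) = c *: ev p q g.
Proof. by rewrite -mul_mpolyC rmorphM /= evC mul_polyC. Qed.

Lemma size_linear_mul (c c' : F) P k : (size P <= k)%N ->
  (size ((c%:P + c' *: 'X) * P)%R <= k.+1)%N.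
Proof.
move=> sP; apply: leq_trans (size_polyMleq _ _) _.
have : (size (c%:P + c' *: 'X)%R <= 2)%N.
  rewrite (leq_trans (size_polyD _ _)) // geq_max (leq_trans (size_polyC_leq1 _)) //.
  by rewrite (leq_trans (size_scale_leq _ _)) // size_polyX.
lia.
Qed.

Lemma size_ev p q k g : g \is k.-homog -> (size (ev p q g) <= k.+1)%N.
Proof.
move: k g; apply: homog_ind => [k|k g h hg hh|k c g hg||k j g hg].
- by rewrite rmorph0 size_poly0.
- by rewrite rmorphD (leq_trans (size_polyD _ _)) // geq_max hg.
- by rewrite evZ (leq_trans (size_scale_leq _ _)).
- by rewrite rmorph1 size_poly1.
- by rewrite rmorphM /= evX size_linear_mul.
Qed.

Lemma horner_ev p q g t : (ev p q g).[t] = g.@[fun j => p j + t * q j].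
Proof.
rewrite (mpolyE g) !raddf_sum /= horner_sum; apply: eq_bigr => m _.
rewrite evZ hornerZ mevalZ mevalX; congr (_ * _).
rewrite /ev mmapX /mmap1 horner_prod; apply: eq_bigr => j _.
by rewrite horner_exp !hornerE [q j * t]mulrC.
Qed.

(* The points of the line [l = 0] are the [a p + b q], and [u, v] are the
   coordinates [a, b] on it; [ev p q] is the restriction to its chart [u = 1]. *)
Record frame l p q u v : Prop := Frame {
  fr_l0 : l != 0;
  fr_l1 : l \is 1.-homog;
  fr_u1 : u \is 1.-homog;
  fr_v1 : v \is 1.-homog;
  fr_u : forall a b, u.@[fun j => a * p j + b * q j] = a;
  fr_v : forall a b, v.@[fun j => a * p j + b * q j] = b;
  fr_l : forall a b, l.@[fun j => a * p j + b * q j] = 0;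
  fr_dec : exists w, forall j, 'X_j = p j *: u + q j *: v + w j *: l
}.

Lemma frame_swap l p q u v : frame l p q u v -> frame l q p v u.
Proof.
case=> l0 l1 u1 v1 hu hv hl [w hw]; split=> //.
- by move=> a b; rewrite -[RHS](hv b a); apply: meval_eq => j; rewrite addrC.
- by move=> a b; rewrite -[RHS](hu b a); apply: meval_eq => j; rewrite addrC.
- by move=> a b; rewrite -[RHS](hl b a); apply: meval_eq => j; rewrite addrC.
- by exists w => j; rewrite hw [q j *: v + _]addrC.
Qed.

Lemma ev_linear p q g : g \is 1.-homog ->
  ev p q g = (g.@[p])%:P + (g.@[fun j => p j + q j] - g.@[p]) *: 'X.
Proof.
move=> /(size_ev p q) sg.
have E : ev p q g = ((ev p q g)`_0)%:P + (ev p q g)`_1 *: 'X.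
  apply/polyP => i; rewrite coefD coefC coefZ coefX.
  case: i => [|[|i]] /=; rewrite ?mulr0 ?addr0 ?mulr1 ?add0r //.
  by rewrite nth_default // (leq_trans sg).
have e0 : (ev p q g).[0] = (ev p q g)`_0 by rewrite horner_coef0.
have e1 : (ev p q g).[1] = (ev p q g)`_0 + (ev p q g)`_1.
  by rewrite {1}E !hornerE.
have h0 : (ev p q g).[0] = g.@[p].
  by rewrite horner_ev; apply: meval_eq => j; rewrite mul0r addr0.
have h1 : (ev p q g).[1] = g.@[fun j => p j + q j].
  by rewrite horner_ev; apply: meval_eq => j; rewrite mul1r.
by rewrite E -h1 -h0 e1 e0 addrAC subrr add0r.
Qed.

Section Frame.
Variables (l u v : S) (p q : 'I_3 -> F).
Hypothesis fr : frame l p q u v.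
Local Notation e := (ev p q).

Let val1 g : g.@[p] = g.@[fun j => 1 * p j + 0 * q j].
Proof. by apply: meval_eq => j; rewrite mul1r mul0r addr0. Qed.

Let val2 g : g.@[fun j => p j + q j] = g.@[fun j => 1 * p j + 1 * q j].
Proof. by apply: meval_eq => j; rewrite !mul1r. Qed.

Lemma ev_u : e u = 1.
Proof.
rewrite (ev_linear _ _ (fr_u1 fr)) val1 val2 !(fr_u fr) subrr scale0r addr0.
exact: polyC1.
Qed.

Lemma ev_v : e v = 'X.
Proof.
by rewrite (ev_linear _ _ (fr_v1 fr)) val1 val2 !(fr_v fr) subr0 scale1r add0r.
Qed.

Lemma ev_l : e l = 0.
Proof.
by rewrite (ev_linear _ _ (fr_l1 fr)) val1 val2 !(fr_l fr) subr0 scale0r addr0.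
Qed.

(** Homogenization in degree [k]: it undoes the restriction for [P] of size at most [k + 1] and
    truncates larger polynomials. *)
Definition lift_ev k P : S := \sum_(i < k.+1) P`_i *: (u ^+ (k - i) * v ^+ i).

Lemma lift_ev_homog k P : lift_ev k P \is k.-homog.
Proof.
apply: rpred_sum => i _; apply: rpredZ.
have := dhomogM (dhomogMn (k - i) (fr_u1 fr)) (dhomogMn i (fr_v1 fr)).
by rewrite !mul1n subnK // -ltnS.
Qed.

Lemma ev_lift k P : (size P <= k.+1)%N -> e (lift_ev k P) = P.
Proof.
move=> sP; rewrite /lift_ev rmorph_sum /=.
under eq_bigr do rewrite evZ rmorphM !rmorphXn /= ev_u ev_v expr1n mul1r.
rewrite -poly_def; apply/polyP => i; rewrite coef_poly; case: ltnP => // h.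
by rewrite nth_default // (leq_trans sP).
Qed.

Lemma lift_evS k P c c' : (size P <= k.+1)%N ->
  lift_ev k.+1 ((c%:P + c' *: 'X) * P) = (c *: u + c' *: v) * lift_ev k P.
Proof.
move=> sP; rewrite mulrDl [RHS]mulrDl.
have -> : lift_ev k.+1 (c%:P * P + c' *: 'X * P) =
    lift_ev k.+1 (c%:P * P) + lift_ev k.+1 (c' *: 'X * P).
  by rewrite /lift_ev -big_split; apply: eq_bigr => i _; rewrite coefD scalerDl.
congr (_ + _).
  rewrite /lift_ev big_ord_recr /= mulr_sumr coefCM nth_default // mulr0 scale0r addr0.
  apply: eq_bigr => i _; rewrite coefCM -scalerAl -scalerAr scalerA mulrA -exprS subSn //.
  by rewrite -ltnS.
rewrite -[c' *: 'X * P]scalerAl -[c' *: v * _]scalerAl /lift_ev big_ord_recl /=.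
rewrite coefZ coefXM mulr0 scale0r add0r mulr_sumr scaler_sumr.
apply: eq_bigr => i _; rewrite coefZ coefXM /= subSS -scalerAr scalerA.
by congr (_ *: _); rewrite exprS mulrCA.
Qed.

(** Modulo [l] each variable is a combination of [u] and [v], so a form is determined modulo [l] by
    its restriction; the induction carries the size bound that [lift_evS] requires. *)
Lemma lift_ev_dec k g : g \is k.-homog -> exists h, g = lift_ev k (e g) + l * h.
Proof.
move=> gk; apply: (proj2 (_ : (size (e g) <= k.+1)%N /\ _)).
move: k g gk; apply: homog_ind
  => [k|k g h [sg [a aE]] [sh [b bE]]|k c g [sg [a aE]]||k j g [sg [a aE]]].
- rewrite rmorph0 size_poly0; split=> //; exists 0; rewrite mulr0 addr0 /lift_ev big1 // => i _.
  by rewrite coef0 scale0r.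
- split; first by rewrite rmorphD (leq_trans (size_polyD _ _)) // geq_max sg.
  exists (a + b); rewrite {1}aE {1}bE rmorphD mulrDr addrACA; congr (_ + _).
  by rewrite /lift_ev -big_split; apply: eq_bigr => i _; rewrite coefD scalerDl.
- split; first by rewrite evZ (leq_trans (size_scale_leq _ _)).
  exists (c *: a); rewrite {1}aE scalerDr -scalerAr; congr (_ + _).
  by rewrite evZ /lift_ev scaler_sumr; apply: eq_bigr => i _; rewrite coefZ scalerA.
- rewrite rmorph1 size_poly1; split=> //; exists 0.
  by rewrite mulr0 addr0 /lift_ev big_ord1 coef1 scale1r expr0 expr0 mulr1.
- split; first by rewrite rmorphM /= evX size_linear_mul.
  have [w wE] := fr_dec fr.
  exists (w j *: g + (p j *: u + q j *: v) * a).
  rewrite rmorphM /= evX lift_evS // {1}wE mulrDl mulrDr {1}aE mulrDr.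
  rewrite -!addrA; congr (_ + _); rewrite addrC -scalerAl -scalerAr; congr (_ + _).
  by rewrite mulrCA.
Qed.


Lemma ev_eq0_dvd k g : g \is k.-homog -> e g = 0 -> exists h, g = l * h.
Proof.
move=> /lift_ev_dec[h gE] eg; exists h; rewrite {1}gE eg /lift_ev big1 ?add0r // => i _.
by rewrite coef0 scale0r.
Qed.

Lemma meval_frame k g a b : g \is k.-homog ->
  g.@[fun j => a * p j + b * q j] = \sum_(i < k.+1) (e g)`_i * (a ^+ (k - i) * b ^+ i).
Proof.
move=> /lift_ev_dec[h gE]; rewrite {1}gE mevalD mevalM (fr_l fr) mul0r addr0.
rewrite /lift_ev raddf_sum; apply: eq_bigr => i _ /=.
by rewrite mevalZ mevalM !rmorphXn /= (fr_u fr) (fr_v fr).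
Qed.

End Frame.

Lemma ev_swap l p q u v k g : frame l p q u v -> g \is k.-homog ->
  ev q p g = \sum_(i < k.+1) (ev p q g)`_i *: 'X^(k - i).
Proof.
move=> fr /(lift_ev_dec fr)[h gE]; rewrite {1}gE; have fr' := frame_swap fr.
rewrite rmorphD rmorphM /= (ev_l fr') mul0r addr0 /lift_ev rmorph_sum.
apply: eq_bigr => i _ /=.
by rewrite evZ rmorphM !rmorphXn /= (ev_v fr') (ev_u fr') expr1n mulr1.
Qed.

(** Such a form restricts to [v ^ k] on the line. *)
Lemma ev_swap1 l p q u v k g : frame l p q u v -> g \is k.-homog ->
  ev q p g = 1 -> ev p q g = 'X^k.
Proof.
move=> fr gk g1; rewrite (ev_swap (frame_swap fr) gk) g1 big_ord_recl /= coef1 scale1r.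
rewrite subn0 big1 ?addr0 // => i _.
by rewrite coef1 scale0r.
Qed.

End Restriction.

(** * Linear dependence in a pencil *)

Section Dependence.
Variable K : fieldType.
Implicit Types (A B C P Q W : {poly K}).

(** A nontrivial relation with coefficients of bounded degree. [e = 0] forces [C = 0] and tests [P],
    [Q] for a common zero, infinity included; [e = 1] allows a constant [C] and tests for a
    section. *)
Definition dependent e k P Q W := exists A B C,
  [/\ (size A <= k)%N, (size B <= k)%N, (size C <= e)%N,
      ~ [/\ A = 0, B = 0 & C = 0] & A * P + B * Q + C * W = 0].

Lemma add_mulXn_eq0 k A B : (size A <= k)%N -> A + B * 'X^k = 0 -> A = 0 /\ B = 0.
Proof.
move=> sA E; have A0 : A = 0.
  apply/polyP => i; rewrite coef0; case: (ltnP i k) => [ik|ki]; last first.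
    by rewrite nth_default // (leq_trans sA).
  by move/(congr1 (fun P : {poly K} => P`_i)): E; rewrite coefD coefMXn ik addr0 coef0.
split=> //; move/eqP: E; rewrite A0 add0r mulf_eq0 expf_eq0 polyX_eq0 andbF orbF.
by move/eqP.
Qed.

Lemma independent_1_Xn k : ~ dependent 0 k 1 'X^k 0.
Proof.
case=> A [B [C [sA sB sC nz]]]; rewrite mulr1 mulr0 addr0.
move/(add_mulXn_eq0 sA) => [A0 B0]; case: nz; split=> //.
by apply/eqP; rewrite -size_poly_eq0 -leqn0.
Qed.

Lemma dependent_root k P Q t : (0 < k)%N -> (size P <= k.+1)%N -> (size Q <= k.+1)%N ->
  P.[t] = 0 -> Q.[t] = 0 -> dependent 0 k P Q 0.
Proof.
move=> k0 sP sQ /rootP/factor_theorem[P1 PE] /rootP/factor_theorem[Q1 QE].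
have sz A : (size (A * ('X - t%:P))%R <= k.+1)%N -> (size A <= k)%N.
  by case: (eqVneq A 0) => [->|A0]; rewrite ?size_poly0 // size_mul ?polyXsubC_eq0 //
     size_XsubC addn2.
have [P10|P10] := eqVneq P1 0.
  exists 1, 0, 0; rewrite size_poly1 !size_poly0; split=> //.
    by case=> /eqP; rewrite oner_eq0.
  by rewrite PE P10 !mul0r mulr0 !addr0.
exists Q1, (- P1), 0; rewrite size_polyN size_poly0; split=> //.
- by apply: sz; rewrite -QE.
- by apply: sz; rewrite -PE.
- by case=> _ /eqP; rewrite oppr_eq0 (negPf P10).
- by rewrite PE QE mulr0 addr0; ring.
Qed.

(** The counterpart of [dependent_root] for two forms of degree [k] vanishing together at
    infinity. *)
Lemma dependent_small k P Q : (0 < k)%N -> (size P <= k)%N -> (size Q <= k)%N ->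
  dependent 0 k P Q 0.
Proof.
move=> k0 sP sQ; have [P0|P0] := eqVneq P 0.
  exists 1, 0, 0; rewrite size_poly1 !size_poly0; split=> //.
    by case=> /eqP; rewrite oner_eq0.
  by rewrite P0 !mul0r mulr0 !addr0.
exists Q, (- P), 0; rewrite size_polyN size_poly0; split=> //.
- by case=> _ /eqP; rewrite oppr_eq0 (negPf P0).
- by rewrite mulr0 addr0; ring.
Qed.

End Dependence.

Section DependenceMatrix.

Definition shift_mx (K : comNzRingType) k n (P : {poly K}) : 'M[K]_(k, n) :=
  \matrix_(i < k, j < n) ('X^i * P)`_j.

Lemma mul_shift_mx (K : comNzRingType) k n (P : {poly K}) (c : 'rV[K]_k) j :
  (c *m shift_mx k n P) 0 j = (rVpoly c * P)`_j.
Proof.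
rewrite {2}(row_sum_delta c) linear_sum /= mulr_suml coef_sum mxE.
by apply: eq_bigr => i _; rewrite linearZ /= rVpoly_delta -scalerAl coefZ mxE.
Qed.

(** A Sylvester-type matrix: its left kernel consists of the relations counted by [dependent], once
    [n] is large enough to avoid truncation. *)
Definition dep_mx (K : comNzRingType) e k n (P Q W : {poly K}) : 'M[K]_(k + k + e, n) :=
  col_mx (col_mx (shift_mx k n P) (shift_mx k n Q)) (shift_mx e n W).

Lemma row_free_dep_mx (K : fieldType) e k n (P Q W : {poly K}) :
  (k + k + e + (size P + size Q + size W) <= n)%N ->
  row_free (dep_mx e k n P Q W) <-> ~ dependent e k P Q W.
Proof.
move=> bn; have bsz d (A T : {poly K}) : (size A <= d)%N ->
    (d <= k + k + e)%N -> (size T <= size P + size Q + size W)%N -> (size (A * T)%R <= n)%N.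
  move=> sA dk sT; apply: leq_trans (size_polyMleq _ _) _.
  move: (size A) (size T) sA sT => x y; lia.
have mulE (a b : 'rV_k) (c : 'rV_e) j :
    (row_mx (row_mx a b) c *m dep_mx e k n P Q W) 0 j =
    (rVpoly a * P + rVpoly b * Q + rVpoly c * W)`_j.
  by rewrite !mul_row_col !coefD -!mul_shift_mx !mxE.
split=> [free [A [B [C [sA sB sC nz E]]]]|indep].
  have : row_mx (row_mx (poly_rV A) (poly_rV B)) (poly_rV C) = 0 :> 'rV_(k + k + e).
    apply: (row_free_inj free); rewrite mul0mx; apply/rowP => j.
    by rewrite mulE !poly_rV_K // E coef0 mxE.
  rewrite -[0](@row_mx0 K 1 (k + k) e) -(@row_mx0 K 1 k k).
  case/eq_row_mx => /eq_row_mx[a0 b0] c0.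
  by apply: nz; rewrite -(poly_rV_K sA) -(poly_rV_K sB) -(poly_rV_K sC) a0 b0 c0 !linear0.
apply: inj_row_free => w.
rewrite -[w]hsubmxK -[lsubmx w]hsubmxK; set a := lsubmx _; set b := rsubmx (lsubmx _).
set c := rsubmx w => w0.
have E : rVpoly a * P + rVpoly b * Q + rVpoly c * W = 0.
  apply/polyP => j; rewrite coef0; case: (ltnP j n) => jn; last first.
    have s3 d (x : 'rV_d) (T : {poly K}) : (d <= k + k + e)%N ->
        (size T <= size P + size Q + size W)%N -> (rVpoly x * T)`_j = 0.
      move=> dk sT; rewrite nth_default // (leq_trans _ jn) // (bsz d) //; exact: size_poly.
    by rewrite !coefD !s3 ?addr0 //; move: (size P) (size Q) (size W) => x y z; lia.
  by have /rowP/(_ (Ordinal jn)) := w0; rewrite mulE mxE.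
have [a0 b0 c0] : [/\ rVpoly a = 0, rVpoly b = 0 & rVpoly c = 0].
  apply: contrapT => nz; apply: indep; exists (rVpoly a), (rVpoly b), (rVpoly c).
  by split=> //; exact: size_poly.
by rewrite -(rVpolyK a) -(rVpolyK b) -(rVpolyK c) a0 b0 c0 !linear0 !row_mx0.
Qed.

Definition spec (K : comNzRingType) (t : K) : {poly {poly K}} -> {poly K} :=
  map_poly (horner_eval t).

Lemma size_spec (K : comNzRingType) (t : K) P : (size (spec t P) <= size P)%N.
Proof. exact: size_poly. Qed.

Lemma map_dep_mx (K : comNzRingType) (t : K) e k n (P Q W : {poly {poly K}}) :
  map_mx (horner_eval t) (dep_mx e k n P Q W) =
  dep_mx e k n (spec t P) (spec t Q) (spec t W).
Proof.
have sh d (T : {poly {poly K}}) :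
    map_mx (horner_eval t) (shift_mx d n T) = shift_mx d n (spec t T).
  by apply/matrixP => i j; rewrite !mxE !coefXnM /spec coef_map /=; case: ifP => // _;
     rewrite /horner_eval horner0.
by rewrite /dep_mx !map_col_mx !sh.
Qed.

(** Full row rank is open: a right inverse [X] of the matrix at [t0] is kept fixed, and the
    determinant of the matrix at [t] times [X] is a polynomial in [t] equal to 1 at [t0]. *)
Lemma independent_generic (K : fieldType) e k (P Q W : {poly {poly K}}) t0 :
  ~ dependent e k (spec t0 P) (spec t0 Q) (spec t0 W) ->
  exists2 D : {poly K}, D != 0 &
    forall t, D.[t] != 0 -> ~ dependent e k (spec t P) (spec t Q) (spec t W).
Proof.
(* Sizes are taken before specialization, so the same [n] serves for every [t]. *)
pose n := (k + k + e + (size P + size Q + size W))%N.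
have bn t : (k + k + e + (size (spec t P) + size (spec t Q) + size (spec t W)) <= n)%N.
  by rewrite leq_add2l !leq_add ?size_spec.
move=> /(row_free_dep_mx (bn t0))/row_freeP[X X1].
pose M := dep_mx e k n P Q W *m map_mx (@polyC K) X.
have ME t : map_mx (horner_eval t) M =
    dep_mx e k n (spec t P) (spec t Q) (spec t W) *m X.
  rewrite map_mxM map_dep_mx; congr (_ *m _); apply/matrixP => i j.
  by rewrite !mxE /= /horner_eval hornerC.
have DE t : (\det M).[t] = \det (dep_mx e k n (spec t P) (spec t Q) (spec t W) *m X).
  by rewrite -ME det_map_mx.
exists (\det M) => [|t Dt].
  have : (\det M).[t0] != 0 by rewrite DE X1 det1 oner_eq0.
  by apply: contraNneq => ->; rewrite horner0.
apply/(row_free_dep_mx (bn t)); apply: inj_row_free => w w0.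
have : row_free (dep_mx e k n (spec t P) (spec t Q) (spec t W) *m X).
  by rewrite row_free_unit unitmxE unitfE -DE.
by move/row_free_inj => /(_ _ w 0); apply; rewrite mulmxA w0 !mul0mx.
Qed.

End DependenceMatrix.

(** * Sections of the bundle of syzygies on a line *)

(** The Nullstellensatz in one variable: an element of least size generates, and without a root it
    is constant. *)
Lemma ideal_no_zero (K : closedFieldType) (I : {poly K} -> Prop) :
  (forall P Q, I P -> I Q -> I (P + Q)) -> (forall A P, I P -> I (A * P)) ->
  (forall t, exists2 P, I P & P.[t] != 0) -> I 1.
Proof.
move=> ID IM Inz.
have [D [ID' D0 Dmin]] : exists D, [/\ I D, D != 0 &
    forall E, I E -> E != 0 -> (size D <= size E)%N].
  have : exists n, `[< exists D, [/\ I D, D != 0 & size D = n] >].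
    have [P IP P0] := Inz 0; exists (size P); apply/asboolP; exists P; split=> //.
    by apply: contraNneq P0 => ->; rewrite horner0.
  move/ex_minnP => -[n /asboolP[D [ID' D0 Dn]] nmin]; exists D; split=> // E IE E0.
  by rewrite Dn; apply: nmin; apply/asboolP; exists E.
have dvdD E : I E -> (D %| E)%R.
  move=> IE; apply: contraT => r0; have IE' : I (E %% D).
    have -> : E %% D = E - E %/ D * D.
      by rewrite {2}(divp_eq E D) addrAC subrr add0r.
    by rewrite -mulNr; apply: ID => //; apply: IM.
  by have := Dmin _ IE' r0; rewrite leqNgt ltn_modp D0.
have : size D == 1%N.
  apply/negPn/negP => /closed_rootP[t Dt]; have [P IP] := Inz t.
  by case/dvdpP: (dvdD P IP) => A ->; rewrite hornerM (rootP Dt) mulr0 eqxx.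
case/size_poly1P => c c0 DE.
by have := IM (c^-1)%:P _ ID'; rewrite DE -polyCM mulVf.
Qed.

Section Family.
Variable F : numFieldType.
Implicit Types (P Q : 'I_3 -> {poly F}) (g : {mpoly F[3]}).

(** The outer variable is the coordinate on the line, the inner one the parameter of the moving
    points [P], [Q]; [spec t] fixes the latter. *)
Definition ev_family P Q g : {poly {poly F}} :=
  mmap (fun c => c%:P%:P) (fun j => (P j)%:P + Q j *: 'X) g.

Lemma spec_ev_family P Q g t :
  spec t (ev_family P Q g) = ev (fun j => (P j).[t]) (fun j => (Q j).[t]) g.
Proof.
rewrite /spec /ev_family /ev /mmap (rmorph_sum (map_poly (horner_eval t))).
apply: eq_bigr => m _; rewrite rmorphM /= map_polyC /= /horner_eval hornerC.
congr (_ * _); rewrite /mmap1 (rmorph_prod (map_poly (horner_eval t))); apply: eq_bigr => j _.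
by rewrite (rmorphXn (map_poly (horner_eval t))) rmorphD /= map_polyC map_polyZ map_polyX.
Qed.

End Family.

Section Sections.
Variable F : numClosedFieldType.
Local Notation S := {mpoly F[3]}.
Implicit Types (a b c m : 'rV[S]_3).

Definition evv (p q : 'I_3 -> F) a : 'rV[{poly F}]_3 := map_mx (ev p q) a.

Lemma evvD p q a b : evv p q (a + b) = evv p q a + evv p q b.
Proof. by apply/rowP => j; rewrite !mxE rmorphD. Qed.

Lemma evvN p q a : evv p q (- a) = - evv p q a.
Proof. by apply/rowP => j; rewrite !mxE rmorphN. Qed.

Lemma evvZ p q g a : evv p q (g *: a) = ev p q g *: evv p q a.
Proof. by apply/rowP => j; rewrite !mxE rmorphM. Qed.

Definition syzh (f : S) n a := syz f a /\ homv n a.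

Lemma syzhZ f k n g a : g \is k.-homog -> syzh f n a -> syzh f (k + n) (g *: a).
Proof. by move=> gm [sa ha]; split; [exact: syzZ | exact: homvZ]. Qed.

Lemma syzhD f n a b : syzh f n a -> syzh f n b -> syzh f n (a + b).
Proof. by move=> [sa ha] [sb hb]; split; [exact: syzD | exact: homvD]. Qed.

Lemma syzhN f n a : syzh f n a -> syzh f n (- a).
Proof. by move=> [sa ha]; split; [exact: syzN | exact: homvN]. Qed.

(* [E_L(e)] has a nonzero section, given by [m1 / u^N] and [m2 / v^N] on the two
   charts of the line [L] with coordinates [u, v]. *)
Definition has_section (f : S) p q (e : int) := exists N n m1 m2,
  [/\ n%:Z = N%:Z + e, syzh f n m1, syzh f n m2,
      evv p q m2 = 'X^N *: evv p q m1 & evv p q m1 != 0].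

Variables (f : S) (d : nat).
Hypotheses (d_gt0 : (0 < d)%N) (f_homog : f \is d.-homog) (f_neq0 : f != 0).
Hypothesis f_reduced : forall g h, f = g ^+ 2 * h -> exists k : F, g = k%:MP.
Variables (r : nat) (rho : 'rV[S]_3).
Hypotheses (rhoP : syzh f r rho) (rho_neq0 : rho != 0).
Hypothesis r_min : forall k a, (k < r)%N -> syzh f k a -> a = 0.

Local Notation om := (omega f).
Let omE := omega_dependence d_gt0 f_homog f_neq0 f_reduced.
Let omC := omegaC f_homog f_neq0 f_reduced.
Let omZ := omegaZr f_homog f_neq0 f_reduced.
Let omD := omegaDr f_homog f_neq0 f_reduced.
Let omB := omegaBr f_homog f_neq0 f_reduced.
Let om_homog := omega_homog f_homog f_neq0 f_reduced.
Let om_homog_lt := omega_homog_lt f_homog f_neq0 f_reduced.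

Section Frame.
Variables (l u v : S) (p q : 'I_3 -> F).
Hypothesis fr : frame l p q u v.

(** The last clause compensates for the truncated [n.-1] at [n = 0], where only [b = 0] is
    possible. *)
Lemma evv_eq0_dvd n a : syzh f n a -> evv p q a = 0 ->
  exists b, [/\ a = l *: b, syzh f n.-1 b & n = 0%N -> b = 0].
Proof.
case=> sa ha /rowP ea.
have /choice[b bE] : forall j, exists h, a 0 j = l * h.
  by move=> j; apply: (ev_eq0_dvd fr (ha j)); have := ea j; rewrite !mxE.
have aE : a = l *: \row_j b j by apply/rowP => j; rewrite !mxE bE.
have n0 : n = 0%N -> \row_j b j = 0.
  move=> n0; apply/rowP => j; rewrite !mxE.
  apply: (dhomog_divl_lt (fr_l0 fr) (fr_l1 fr) (k := 0)) => //.
  by have := ha j; rewrite n0 bE.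
exists (\row_j b j); split=> //; split; first by apply: (syzZI (fr_l0 fr)); rewrite -aE.
case: (posnP n) => [/n0 ->|n_gt0] j; first by rewrite mxE rpred0.
rewrite mxE; apply: (dhomog_divl (fr_l0 fr) (fr_l1 fr)).
by rewrite -bE add1n prednK.
Qed.

Lemma ev_omega_eq0 n a b : syzh f n a -> syz f b -> evv p q a = 0 -> ev p q (om b a) = 0.
Proof.
move=> sa sb /(evv_eq0_dvd sa)[c [-> [sc _] _]].
by rewrite omZ // rmorphM /= (ev_l fr) mul0r.
Qed.

(** [v ^ N a - u ^ N a'] vanishes on the line, so pairing with [b] respects the gluing of the two
    halves of a section. *)
Lemma ev_omega_scale N n a a' b : syzh f n a -> syzh f n a' -> syz f b ->
  evv p q a' = 'X^N *: evv p q a -> ev p q (om b a') = 'X^N * ev p q (om b a).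
Proof.
move=> sa sa' sb E; apply/esym/eqP; rewrite -subr_eq0; apply/eqP.
have hu : u ^+ N \is N.-homog by have := dhomogMn N (fr_u1 fr); rewrite mul1n.
have hv : v ^+ N \is N.-homog by have := dhomogMn N (fr_v1 fr); rewrite mul1n.
have s1 := syzhZ hv sa; have s2 := syzhZ hu sa'.
have := ev_omega_eq0 (syzhD s1 (syzhN s2)) sb.
rewrite (omB sb (proj1 s1) (proj1 s2)) (omZ _ sb (proj1 sa)) (omZ _ sb (proj1 sa')).
rewrite rmorphB !rmorphM !rmorphXn /= (ev_u fr) (ev_v fr) expr1n mul1r; apply.
rewrite evvD evvN !evvZ !rmorphXn /= (ev_u fr) (ev_v fr) expr1n scale1r E.
exact: subrr.
Qed.

(** Otherwise [rho / l] would be a nonzero syzygy of degree [r - 1], against the minimality of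
    [r]. *)
Lemma evv_rho : evv p q rho != 0.
Proof.
apply: contra_neq rho_neq0 => /(evv_eq0_dvd rhoP)[b [-> sb b0]].
case: (posnP r) => [/b0 ->|r0]; first by rewrite scaler0.
by rewrite (r_min _ sb) ?scaler0 // ltn_predL.
Qed.

End Frame.

(* [L = <p, q>] avoids [Z] near the points [p + t q]. *)
Definition Zfree p q := exists K n m,
  [/\ (n + r).+1 = (K + d)%N, syzh f n m & ev p q (om rho m) = 1].

(** * The lower bound for twists with a section *)

Section KernelBound.
Variables (l u v : S) (p q : 'I_3 -> F).
Hypothesis fr : frame l p q u v.
Local Notation e := (ev p q).
Local Notation ee := (evv p q).

Lemma syz_rho : syz f rho. Proof. exact: (proj1 rhoP). Qed.

(* A section of [E_L(n - N)] killed by [v] is a multiple of [rho]. *)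
Lemma kernel_section N n m1 m2 : Zfree p q -> Zfree q p ->
  syzh f n m1 -> syzh f n m2 -> ee m2 = 'X^N *: ee m1 -> ee m1 != 0 ->
  e (om rho m1) = 0 -> (N + r <= n)%N.
Proof.
move=> [K [n1 [m [nE sm h1]]]] [K' [n' [m' [nE' sm' h1']]]] s1 s2 E m10 v0.
have sr := syz_rho.
have [a1 a2 am am'] := And4 (proj1 s1) (proj1 s2) (proj1 sm) (proj1 sm').
have h2 : e (om rho m') = 'X^K'.
  apply: (ev_swap1 fr) h1'; apply: om_homog (proj2 rhoP) (proj2 sm') _ => //.
  by rewrite -nE' addnC.
have w0 : e (om rho m2) = 0.
  by rewrite (ev_omega_scale fr s1 s2 sr E) v0 mulr0.
(* In the relation between [m1], [rho] and [m] the coefficient of [m1] is 1 and that of [m] is zero,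
   so the factor of [rho] has no pole in this chart; [E2] does the same at infinity. *)
have E1 : ee m1 = e (om m1 m) *: ee rho.
  have /(congr1 ee) := omE a1 sr am.
  rewrite !evvD evvN !evvZ h1 scale1r (omC a1 sr) rmorphN /= v0 oppr0 scale0r addr0.
  by rewrite /evv raddf0 => /eqP; rewrite subr_eq0 => /eqP.
have E2 : 'X^K' *: ee m2 = e (om m2 m') *: ee rho.
  have /(congr1 ee) := omE a2 sr am'.
  rewrite !evvD evvN !evvZ h2 (omC a2 sr) rmorphN /= w0 oppr0 scale0r addr0.
  by rewrite /evv raddf0 => /eqP; rewrite subr_eq0 => /eqP.
have /rV0Pn[j rj] := evv_rho fr.
have W0 : e (om m1 m) != 0.
  by apply: contra_neq m10 => W0; rewrite E1 W0 scale0r.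
have EW : 'X^(K' + N) * e (om m1 m) = e (om m2 m').
  apply: (mulIf rj); move/rowP/(_ j): E2; rewrite E E1 !mxE => <-.
  by rewrite exprD !mulrA.
have W'0 : e (om m2 m') != 0 by rewrite -EW mulf_neq0 // expf_neq0 // polyX_eq0.
case: (ltnP (n + n').+1 d) => [lt|ge].
  by move: W'0; rewrite (om_homog_lt a2 am' (proj2 s2) (proj2 sm') lt) rmorph0 eqxx.
(* The form [omega(m2, m')] has degree [n + n' + 1 - d = n + K' - r] and is divisible by
   [X ^ (K' + N)], whence [N + r <= n]. *)
have := size_ev p q (om_homog (k := (n + n').+1 - d) a2 am' (proj2 s2) (proj2 sm') (subnK ge)).
rewrite -EW size_mul // ?expf_neq0 ?polyX_eq0 // size_polyXn.
have := W0; rewrite -size_poly_gt0; move: (size (e (om m1 m))) => z; lia.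
Qed.

(** If [v] does not kill the section, its image is a nonzero section of [O_L(k + r - d + 1)], so
    this degree is nonnegative; if it does, then [k >= r >= d - r]. *)
Lemma section_lower (k : int) : Zfree p q -> Zfree q p -> (d <= 2 * r)%N ->
  has_section f p q k -> d%:Z - 1 - r%:Z <= k.
Proof.
move=> Z1 Z2 dr [N [n [m1 [m2 [nE s1 s2 E m10]]]]].
rewrite leNgt; apply/negP => klt.
suff v0 : e (om rho m1) = 0.
  have := kernel_section Z1 Z2 s1 s2 E m10 v0; lia.
have sr := syz_rho.
have Ev := ev_omega_scale fr s1 s2 sr E.
apply/eqP; apply: contraT => v0.
have w0 : e (om rho m2) != 0.
  by rewrite Ev mulf_neq0 // expf_neq0 // polyX_eq0.
case: (ltnP (r + n).+1 d) => [lt|ge].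
  by move: w0; rewrite (om_homog_lt sr (proj1 s2) (proj2 rhoP) (proj2 s2) lt) rmorph0 eqxx.
have := size_ev p q
  (om_homog (k := (r + n).+1 - d) sr (proj1 s2) (proj2 rhoP) (proj2 s2) (subnK ge)).
rewrite Ev size_mul // ?expf_neq0 ?polyX_eq0 // size_polyXn.
have := v0; rewrite -size_poly_gt0; move: (size (e (om rho m1))) => z; lia.
Qed.

End KernelBound.

(** [B(C, rho1)] is generated here by images of arbitrary syzygies; the components reduce it to
    homogeneous ones. *)
Definition hcomp k a : 'rV[S]_3 := \row_j pihomog mdeg k (a 0 j).

Lemma syzh_hcomp k a : syz f a -> syzh f k (hcomp k a).
Proof.
move=> sa; split; last by move=> j; rewrite mxE pihomogP.
have := congr1 (pihomog mdeg (d.-1 + k)) sa.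
rewrite (raddf_sum (pihomog mdeg (d.-1 + k))) pihomog0 => h.
apply: etrans h; apply: eq_bigr => j _ /=; rewrite mxE mulrC [a 0 j * _]mulrC pihomogMl //.
by apply: dhomog_mderiv; rewrite prednK.
Qed.

Lemma hcomp_sum a : exists B, a = \sum_(k < B) hcomp k a.
Proof.
exists (\max_j msize (a 0%R j)); apply/rowP => j; rewrite summxE.
rewrite (eq_bigr (fun k : 'I__ => pihomog mdeg k (a 0 j))) => [|k _]; last by rewrite mxE.
apply: pihomog_partitionE.
exact: (leq_bigmax j).
Qed.

Lemma omega_sum (I : Type) (s : seq I) (G : I -> 'rV[S]_3) b : syz f b ->
  (forall i, syz f (G i)) -> om b (\sum_(i <- s) G i) = \sum_(i <- s) om b (G i).
Proof.
move=> sb sG; suff [] : syz f (\sum_(i <- s) G i) /\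
    om b (\sum_(i <- s) G i) = \sum_(i <- s) om b (G i) by [].
elim: s => [|i s [sI IH]].
  rewrite !big_nil; split; first by rewrite /syz big1 // => j _; rewrite mxE mul0r.
  by have := omZ 0 sb sb; rewrite scale0r mul0r.
by rewrite !big_cons; split; [exact: syzD | rewrite omD // IH].
Qed.

(** On the chart the restrictions of images of homogeneous syzygies form an ideal, since degrees can
    be equalized by powers of [u], which restricts to 1. It has no zero, as the points [p + t q] lie
    on [l]; hence it contains 1. *)
Lemma Zfree_of_avoid l p q u v : frame l p q u v ->
  (forall x, (exists j, x j != 0) -> (forall b, syz f b -> (om rho b).@[x] = 0) ->
     l.@[x] != 0) ->
  Zfree p q.
Proof.
move=> fr avoid; have sr := syz_rho.
pose I P := exists K n m,
  [/\ (n + r).+1 = (K + d)%N, syzh f n m & ev p q (om rho m) = P].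
apply: (ideal_no_zero (I := I)).
- move=> P Q [K [n [m [nE sm <-]]]] [K' [n' [m' [nE' sm' <-]]]].
  have hu k : u ^+ k \is k.-homog by have := dhomogMn k (fr_u1 fr); rewrite mul1n.
  have s1 := syzhZ (hu K') sm; have s2 := syzhZ (hu K) sm'.
  have nn : (K' + n = K + n')%N by lia.
  exists (K + K')%N, (K' + n)%N, (u ^+ K' *: m + u ^+ K *: m'); split; first by lia.
    by apply: syzhD => //; rewrite nn.
  rewrite (omD sr (proj1 s1) (proj1 s2)) (omZ _ sr (proj1 sm)) (omZ _ sr (proj1 sm')).
  by rewrite rmorphD !rmorphM !rmorphXn /= (ev_u fr) !expr1n !mul1r.
- move=> A P [K [n [m [nE sm <-]]]].
  have s1 := syzhZ (lift_ev_homog fr (size A) A) sm.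
  exists (size A + K)%N, (size A + n)%N, (lift_ev u v (size A) A *: m); split=> //.
    by lia.
  by rewrite (omZ _ sr (proj1 sm)) rmorphM /= (ev_lift fr).
- move=> t; pose x j := p j + t * q j.
  have xE g : g.@[x] = g.@[fun j => 1 * p j + t * q j].
    by apply: meval_eq => j; rewrite mul1r.
  have : ~ forall b, syz f b -> (om rho b).@[x] = 0.
    move=> /(avoid x); rewrite xE (fr_l fr) eqxx => /(_ _)/negP; apply=> //.
    apply: contrapT => /forallNP x0.
    have := fr_u fr 1 t; rewrite -xE (meval_eq (v2 := fun j => 0 * x j)); last first.
      by move=> j; have /negP/negPn/eqP -> := x0 j; rewrite mulr0.
    by rewrite (mevalZ_homog 0 x (fr_u1 fr)) expr1 mul0r => /esym/eqP; rewrite oner_eq0.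
  move=> /existsNP[b /not_implyP[sb /eqP]].
  have [B bE] := hcomp_sum b.
  rewrite {1}bE omega_sum // => [|k]; last exact: (proj1 (syzh_hcomp _ sb)).
  rewrite raddf_sum => h.
  have [k hk] : exists k : 'I_B, (om rho (hcomp k b)).@[x] != 0.
    apply: contrapT => /forallNP h0; case/negP: h; apply/eqP; apply: big1 => k _.
    by have /negP/negPn/eqP := h0 k.
  have sk := syzh_hcomp k sb.
  exists (ev p q (om rho (hcomp k b))); last by rewrite horner_ev.
  case: (ltnP (r + k).+1 d) => [lt|ge].
    by move: hk; rewrite (om_homog_lt sr (proj1 sk) (proj2 rhoP) (proj2 sk) lt) meval0 eqxx.
  exists ((r + k).+1 - d)%N, k, (hcomp k b); split=> //.
  by rewrite subnK // addnC.
Qed.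

(** The images of [m] and [m'] under [v] restrict to [u ^ K] and [v ^ K], so [m] and [m'] lift a
    generator of the quotient line bundle on the two charts. *)
Definition Zpair p q K n m m' := [/\ (n + r).+1 = (K + d)%N, syzh f n m, syzh f n m',
  ev p q (om rho m) = 1 & ev p q (om rho m') = 'X^K].

Lemma ZpairP l p q u v B : frame l p q u v -> Zfree p q -> Zfree q p ->
  exists K n m m', (B <= K)%N /\ Zpair p q K n m m'.
Proof.
move=> fr [K [n [m [nE sm h1]]]] [K' [n' [m' [nE' sm' h1']]]].
have sr := syz_rho.
have h2 : ev p q (om rho m') = 'X^K'.
  apply: (ev_swap1 fr) h1'; apply: om_homog (proj2 rhoP) (proj2 sm') _ => //.
    exact: (proj1 sm').
  by rewrite -nE' addnC.
have hu k : u ^+ k \is k.-homog by have := dhomogMn k (fr_u1 fr); rewrite mul1n.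
have hv k : v ^+ k \is k.-homog by have := dhomogMn k (fr_v1 fr); rewrite mul1n.
exists (B + K + K')%N, (B + K' + n)%N, (u ^+ (B + K') *: m), (v ^+ (B + K) *: m').
split; first by lia.
split; [by lia | exact: syzhZ | | | ].
- by rewrite (_ : B + K' + n = B + K + n')%N; [exact: syzhZ | lia].
- by rewrite (omZ _ sr (proj1 sm)) rmorphM rmorphXn /= (ev_u fr) expr1n mul1r.
- by rewrite (omZ _ sr (proj1 sm')) rmorphM rmorphXn /= (ev_v fr) h2 -exprD.
Qed.

(** * The extension class and the lifting of sections *)

Section Glue.
Variables (l u v : S) (p q : 'I_3 -> F).
Hypothesis fr : frame l p q u v.
Local Notation e := (ev p q).
Local Notation ee := (evv p q).

(** The two local lifts differ by a multiple of [rho]: [omega(m, m')] is the cocycle of the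
    extension. *)
Lemma Zpair_relation K n m m' : Zpair p q K n m m' ->
  'X^K *: ee m - ee m' = e (om m m') *: ee rho.
Proof.
move=> [nE [sm hm] [sm' hm'] h1 h2]; have sr := syz_rho.
have /(congr1 ee) := omE sm sm' sr.
rewrite !evvD evvN !evvZ (omC sm' sr) (omC sm sr) !rmorphN /= h1 h2.
rewrite !scaleNr scale1r opprK /evv raddf0 => /eqP; rewrite addr_eq0 => /eqP h.
by apply: oppr_inj; rewrite -h opprB addrC.
Qed.

Lemma size_omega_pair K n m m' : Zpair p q K n m m' ->
  (size (e (om m m')) <= 2 * K + d - 2 * r)%N.
Proof.
move=> [nE sm sm' h1 h2].
case: (ltnP (n + n).+1 d) => [lt|ge].
  by rewrite (om_homog_lt (proj1 sm) (proj1 sm') (proj2 sm) (proj2 sm') lt) rmorph0 size_poly0.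
have := size_ev p q (om_homog (proj1 sm) (proj1 sm') (proj2 sm) (proj2 sm') (subnK ge)).
move: (size _) => z; lia.
Qed.

(** A section [Lam] of [O_L(j)] lifts when [Lam] times the extension cocycle is a coboundary; the
    lift is [Lam m - A rho] on one chart and [Lam m' - B rho] on the other. Pairing it with [rho]
    gives back [Lam], so it is nonzero. *)
Lemma glue_section K n m m' j (Lam A B : {poly F}) : Zpair p q K n m m' ->
  (r <= n + j)%N -> Lam != 0 -> (size Lam <= j.+1)%N ->
  (size A <= (n + j - r).+1)%N -> (size B <= (n + j - r).+1)%N ->
  Lam * e (om m m') = 'X^K * A - B ->
  has_section f p q (d%:Z - 1 - r%:Z + j%:Z).
Proof.
move=> ZP rj L0 sL sA sB E; have [nE sm sm' h1 h2] := ZP; have sr := syz_rho.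
have hLf k P : lift_ev u v k P \is k.-homog by apply: lift_ev_homog fr _ _.
pose La := lift_ev u v j Lam; pose al := lift_ev u v (n + j - r) A.
pose be := lift_ev u v (n + j - r) B.
have t1 : syzh f (j + n) (al *: rho).
  by rewrite (_ : j + n = n + j - r + r)%N; [exact: syzhZ (hLf _ _) rhoP | lia].
have t2 : syzh f (j + n) (be *: rho).
  by rewrite (_ : j + n = n + j - r + r)%N; [exact: syzhZ (hLf _ _) rhoP | lia].
have s1 : syzh f (j + n) (La *: m - al *: rho).
  by apply: syzhD; [apply: syzhZ => //; exact: hLf | exact: syzhN].
have s2 : syzh f (j + n) (La *: m' - be *: rho).
  by apply: syzhD; [apply: syzhZ => //; exact: hLf | exact: syzhN].
exists K, (j + n)%N, (La *: m - al *: rho), (La *: m' - be *: rho); split=> //.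
- by lia.
- rewrite !evvD !evvN !evvZ (ev_lift fr sL) (ev_lift fr sA) (ev_lift fr sB).
  have : Lam *: (ee m') = Lam *: ('X^K *: ee m - e (om m m') *: ee rho).
    by rewrite -(Zpair_relation ZP) subKr.
  move=> ->; rewrite !scalerBr !scalerA E [Lam * _]mulrC -addrA; congr (_ + _).
  by rewrite -opprD -scalerDl subrK.
- apply/eqP => /(ev_omega_eq0 fr s1 sr).
  rewrite (omB sr (syzZ La (proj1 sm)) (proj1 t1)) (omZ _ sr (proj1 sm)) (omZ _ sr sr).
  by rewrite omegaxx // mulr0 subr0 rmorphM /= h1 mulr1 (ev_lift fr) // => /eqP; apply/negP.
Qed.

(** For [j = 1] the polynomials [X ^ K A - B] miss [2 r - d - 1] monomials: none, or only
    [X ^ (K - 1)]. The two coefficients of [L] suffice to cancel that one. *)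
Lemma section_upper K n m m' : Zpair p q K n m m' -> (2 < K)%N ->
  (d < 2 * r <= d + 2)%N -> has_section f p q (d%:Z - r%:Z).
Proof.
move=> ZP K3 /andP[dr1 dr2]; have [nE sm sm' h1 h2] := ZP.
rewrite (_ : d%:Z - r%:Z = d%:Z - 1 - r%:Z + 1%N%:Z); last by lia.
have sw := size_omega_pair ZP; set w := e (om m m') in sw *.
(* [L] is chosen so that the coefficient of degree [K - 1] of [L * w] vanishes. *)
pose L : {poly F} := if w`_K.-1 == 0 then 1 else - (w`_K.-2)%:P + w`_K.-1 *: 'X.
have L0 : L != 0.
  rewrite /L; have [_|w0] := eqVneq w`_K.-1 0; first exact: oner_neq0.
  apply: contra_neq w0 => /(congr1 (fun P : {poly F} => P`_1)).
  by rewrite coefD coefN coefC coefZ coefX coef0 /= oppr0 add0r mulr1.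
have sL : (size L <= 2)%N.
  rewrite /L; case: eqP => _; first by rewrite size_poly1.
  rewrite (leq_trans (size_polyD _ _)) // geq_max size_polyN.
  rewrite (leq_trans (size_polyC_leq1 _)) //.
  by rewrite (leq_trans (size_scale_leq _ _)) // size_polyX.
have LK : (L * w)`_K.-1 = 0.
  rewrite /L; case: eqP => [w0|_]; first by rewrite mul1r.
  rewrite mulrDl coefD mulNr coefN coefCM -scalerAl coefZ coefXM.
  by rewrite (_ : (K.-1 == 0%N) = false) ?[_ * w`_K.-2]mulrC ?addNr //; lia.
have sLw : (size (L * w)%R <= (size w).+1)%N.
  by apply: leq_trans (size_polyMleq _ _) _; move: (size w) => z; lia.
apply: (glue_section (K := K) (n := n) (m := m) (m' := m') (j := 1) (Lam := L)
   (A := drop_poly K (L * w)) (B := - take_poly K (L * w))) => //.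
- by lia.
- by rewrite size_drop_poly; move: (size w) (size (L * w)) sw sLw => a b; lia.
- rewrite size_polyN; have : (size (take_poly K (L * w)) <= K.-1)%N.
    apply/leq_sizeP => i Ki; rewrite coef_take_poly; case: ltnP => // iK.
    by have -> : i = K.-1 by lia.
  by move: (size _) => z; lia.
- by rewrite opprK addrC ['X^K * _]mulrC poly_take_drop.
Qed.


Lemma size_ev_omega_section N n m1 m2 k n' b : n%:Z = N%:Z + k ->
  syzh f n m1 -> syzh f n m2 -> ee m2 = 'X^N *: ee m1 -> syzh f n' b ->
  e (om b m1) != 0 -> (size (e (om b m1)))%:Z + d%:Z <= n'%:Z + k + 2%:Z.
Proof.
move=> nE s1 s2 E sb w0; have Ew := ev_omega_scale fr s1 s2 (proj1 sb) E.
have w0' : e (om b m2) != 0 by rewrite Ew mulf_neq0 // expf_neq0 // polyX_eq0.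
case: (ltnP (n' + n).+1 d) => [lt|ge].
  by move: w0'; rewrite (om_homog_lt (proj1 sb) (proj1 s2) (proj2 sb) (proj2 s2) lt) rmorph0 eqxx.
have := size_ev p q (om_homog (proj1 sb) (proj1 s2) (proj2 sb) (proj2 s2) (subnK ge)).
rewrite Ew size_mul ?expf_neq0 ?polyX_eq0 // size_polyXn.
by have := w0; rewrite -size_poly_gt0; move: (size (e (om b m1))) => z; lia.
Qed.

(** The coefficients of the relation are the pairings of the section with [m'], [m] and [rho], by
    the Pluecker identity. [Zpair] is not assumed, because [m] and [m'] are chosen on one line of a
    pencil and used on the others. *)
Lemma section_dependent K n m m' : (n + r).+1 = (K + d)%N ->
  syzh f n m -> syzh f n m' -> (2 * r < K + d)%N ->
  has_section f p q (d%:Z - 1 - r%:Z) ->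
  dependent 1 (K + d - 2 * r) (e (om rho m)) (e (om rho m')) (e (om m m')).
Proof.
move=> nE sm sm' Kd [N [n1 [m1 [m2 [n1E s1 s2 E m10]]]]]; have sr := syz_rho.
have [a1 am am'] := And3 (proj1 s1) (proj1 sm) (proj1 sm').
have sz b n' k : syzh f n' b -> (n' + 1 <= r + k)%N -> (size (e (om m1 b)) <= k)%N.
  move=> sb nk; rewrite (omC a1 (proj1 sb)) rmorphN size_polyN /=.
  have [->|w0] := eqVneq (e (om b m1)) 0; first by rewrite size_poly0.
  by have := size_ev_omega_section n1E s1 s2 E sb w0; move: (size _) => z; lia.
have rel : e (om m1 m') * e (om rho m) - e (om m1 m) * e (om rho m')
    + e (om m1 rho) * e (om m m') = 0.
  have := congr1 e (omega_plucker d_gt0 f_homog f_neq0 f_reduced sr am am' a1).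
  rewrite !rmorphD rmorphN !rmorphM rmorph0 /= => <-; ring.
have [hz|hnz] := eqVneq (e (om rho m)) 0.
  exists 1, 0, 0; rewrite size_poly1 !size_poly0; split=> //; first by lia.
    by case=> /eqP; rewrite oner_eq0.
  by rewrite hz !mul0r mulr0 !addr0.
exists (e (om m1 m')), (- e (om m1 m)), (e (om m1 rho)); split.
- by apply: (sz _ n) => //; lia.
- by rewrite size_polyN; apply: (sz _ n) => //; lia.
- by apply: (sz _ r) => //; lia.
(* If the pairings with [m] and [rho] vanish, the three-term relation leaves [omega(rho, m) m1 = 0]
   on the line. *)
- case=> _ /eqP; rewrite oppr_eq0 => /eqP w1 w2.
  have /rV0Pn[j mj] := m10; case/negP: mj.
  have /(congr1 ee) := omE a1 sr am.
  rewrite !evvD evvN !evvZ w1 w2 !scale0r subr0 addr0.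
  rewrite /evv raddf0 => /rowP/(_ j); rewrite !mxE => /eqP.
  by rewrite mulf_eq0 (negPf hnz).
- by rewrite mulNr rel.
Qed.

(** [1] and [X ^ K] admit no relation of small degree, so [C] is a nonzero constant; dividing by it
    makes the cocycle itself a coboundary, and [Lam = 1] lifts. *)
Lemma dependent_section K n m m' : Zpair p q K n m m' ->
  (2 * r < K + d)%N -> (d <= 2 * r)%N ->
  dependent 1 (K + d - 2 * r) 1 'X^K (e (om m m')) ->
  has_section f p q (d%:Z - 1 - r%:Z).
Proof.
move=> ZP Kd dr [A [B [C [sA sB sC nz]]]]; rewrite mulr1 => E.
have [nE _ _ _ _] := ZP.
have [C0|C0] := eqVneq C 0.
  case: nz; move: E; rewrite C0 mul0r addr0 => /add_mulXn_eq0[|-> ->] //.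
  by apply: leq_trans sA _; lia.
have /size_poly1P[c c0 CE] : size C == 1%N by rewrite eqn_leq sC size_poly_gt0.
rewrite -[X in has_section _ _ _ X](addr0); change (0 : int) with (0%N%:Z).
apply: (glue_section (Lam := 1) (A := - c^-1 *: B) (B := c^-1 *: A) ZP).
- by lia.
- by rewrite oner_eq0.
- by rewrite size_poly1.
- by apply: leq_trans (size_scale_leq _ _) (leq_trans sB _); lia.
- by apply: leq_trans (size_scale_leq _ _) (leq_trans sA _); lia.
move: E; rewrite CE mul_polyC => /eqP; rewrite addrC addr_eq0 => /eqP E.
have -> : e (om m m') = c^-1 *: (c *: e (om m m')) by rewrite scalerA mulVf // scale1r.
by rewrite mul1r E scalerN scalerDr opprD addrC scaleNr mulrN -scalerAr ['X^K * _]mulrC.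
Qed.

(** A point of [Z] on the line is a common zero of both images, either at the parameter [be / al]
    or, if [al = 0], at infinity; both give a relation of size [K]. *)
Lemma independent_Zfree K n m m' : (0 < K)%N -> (n + r).+1 = (K + d)%N ->
  syzh f n m -> syzh f n m' ->
  ~ dependent 0 K (e (om rho m)) (e (om rho m')) 0 -> Zfree p q /\ Zfree q p.
Proof.
move=> K0 nE sm sm' indep; have sr := syz_rho.
have hh b : syzh f n b -> om rho b \is K.-homog.
  move=> sb; apply: om_homog (proj2 rhoP) (proj2 sb) _ => //; first exact: (proj1 sb).
  by rewrite -nE addnC.
have avoid x : (exists j, x j != 0) -> (forall b, syz f b -> (om rho b).@[x] = 0) ->
    l.@[x] != 0.
  move=> [j xj] xZ; apply/negP => /eqP lx; apply: indep.
  have [w wE] := fr_dec fr; pose al := u.@[x]; pose be := v.@[x].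
  have xE i : x i = al * p i + be * q i.
    have := congr1 (meval x) (wE i); rewrite !mevalD !mevalZ lx mulr0 addr0 mevalXU => ->.
    by rewrite mulrC [be * _]mulrC.
  have Z0 b : syzh f n b -> \sum_(i < K.+1) (e (om rho b))`_i * (al ^+ (K - i) * be ^+ i) = 0.
    by move=> sb; rewrite -(meval_frame fr _ _ (hh _ sb)) -(xZ b (proj1 sb)); apply: meval_eq => i.
  have [al0|al0] := eqVneq al 0; last first.
    have root b : syzh f n b -> (e (om rho b)).[be / al] = 0.
      move=> sb; apply: (mulfI (expf_neq0 K al0)); rewrite mulr0 -(Z0 b sb).
      rewrite (horner_coef_wide _ (size_ev p q (hh _ sb))) mulr_sumr; apply: eq_bigr => i _.
      rewrite mulrCA; congr (_ * _); have iK : (i <= K)%N by rewrite -ltnS.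
      rewrite -{1}(subnK iK) exprD -mulrA -exprMn [al * _]mulrC divfK //.
    by apply: (dependent_root K0 _ _ (root m sm) (root m' sm')); apply: size_ev; apply: hh.
  have be0 : be != 0.
    by apply: contra_neq xj => be0; rewrite xE al0 be0 !mul0r addr0.
  have sml b : syzh f n b -> (size (e (om rho b)) <= K)%N.
    move=> sb; apply/leq_sizeP => i; rewrite leq_eqVlt => /orP[/eqP <-|Ki]; last first.
      by rewrite nth_default // (leq_trans (size_ev p q (hh _ sb))).
    have := Z0 b sb; rewrite big_ord_recr /= subnn expr0 mul1r big1 ?add0r => [|i' _].
      by move/eqP; rewrite mulf_eq0 expf_eq0 (negPf be0) andbF orbF => /eqP.
    by rewrite al0 expr0n subn_eq0 leqNgt ltn_ord mul0r mulr0.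
  by apply: dependent_small; rewrite ?sml.
split; first exact: Zfree_of_avoid fr avoid.
exact: Zfree_of_avoid (frame_swap fr) avoid.
Qed.

End Glue.

(** [m] and [m'] are fixed at [t0] and restricted to all lines of the family. Independence for
    [e = 0] keeps the line off [Z], independence for [e = 1] excludes a section; both are open in
    [t]. *)
Lemma generic_line (l : F -> S) (u v : S) (P Q : 'I_3 -> {poly F}) (t0 : F) :
  (forall t, frame (l t) (fun j => (P j).[t]) (fun j => (Q j).[t]) u v) ->
  let p t j := (P j).[t] in let q t j := (Q j).[t] in
  Zfree (p t0) (q t0) -> Zfree (q t0) (p t0) -> (d < 2 * r <= d + 2)%N ->
  exists2 D : {poly F}, D != 0 & forall t, D.[t] != 0 ->
    [/\ Zfree (p t) (q t), Zfree (q t) (p t) &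
       has_section f (p t) (q t) (d%:Z - 1 - r%:Z) ->
       has_section f (p t0) (q t0) (d%:Z - 1 - r%:Z)].
Proof.
move=> fr p q Z1 Z2 /andP[dr1 dr2].
have [K [n [m [m' [K3 ZP]]]]] := ZpairP 3 (fr t0) Z1 Z2.
have [nE sm sm' h1 h2] := ZP.
have [D0 D00 D0P] : exists2 D : {poly F}, D != 0 & forall t, D.[t] != 0 ->
    ~ dependent 0 K (ev (p t) (q t) (om rho m)) (ev (p t) (q t) (om rho m')) 0.
  have [] := @independent_generic F 0 K (ev_family P Q (om rho m))
     (ev_family P Q (om rho m')) 0 t0.
    rewrite !spec_ev_family h1 h2 /spec raddf0; exact: independent_1_Xn.
  move=> D D0 DP; exists D => // t /DP; rewrite !spec_ev_family /spec raddf0.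
  by apply.
have K0 : (0 < K)%N by lia.
have Zt t : D0.[t] != 0 -> Zfree (p t) (q t) /\ Zfree (q t) (p t).
  by move=> /D0P nd; exact: (independent_Zfree (fr t) K0 nE sm sm' nd).
have Kd : (2 * r < K + d)%N by lia.
case: (pselect (has_section f (p t0) (q t0) (d%:Z - 1 - r%:Z))) => [hs|nhs].
  by exists D0 => // t /Zt[].
have [] := @independent_generic F 1 (K + d - 2 * r) (ev_family P Q (om rho m))
   (ev_family P Q (om rho m')) (ev_family P Q (om m m')) t0.
  rewrite !spec_ev_family h1 h2 => dep; apply: nhs.
  by apply: (dependent_section (fr t0) ZP) => //; exact: ltnW.
move=> D1 D10 D1P; exists (D0 * D1) => [|t]; first by rewrite mulf_neq0.
rewrite hornerM mulf_eq0 negb_or => /andP[/Zt[Zt1 Zt2] /D1P].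
rewrite !spec_ev_family => nd; split=> // hs; case: nd.
exact: (section_dependent (fr t) nE sm sm' Kd hs).
Qed.

End Sections.

(** * Splitting types and sections *)

Section FractionEvaluation.
Variable F : numFieldType.
Local Notation S := {mpoly F[3]}.
Variables p q : 'I_3 -> F.
Local Notation e := (ev p q).
Local Notation K := {fraction {poly F}}.
Local Notation "x %:f" := (@tofrac _ x) (at level 2, format "x %:f").

(* [s] is a rational function without pole along [L], and [y] its restriction to [L]. *)
Definition evf (s : {fraction S}) (y : K) :=
  exists a b : S, [/\ e b != 0, s = a%:f / b%:f & y = (e a)%:f / (e b)%:f].

Lemma ev_neq0 b : e b != 0 -> b != 0.
Proof. by apply: contraNneq => ->; rewrite rmorph0. Qed.

Lemma evf_frac a b : e b != 0 -> evf (a%:f / b%:f) ((e a)%:f / (e b)%:f).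
Proof. by exists a, b. Qed.

Lemma evf_uniq s y y' : evf s y -> evf s y' -> y = y'.
Proof.
move=> [a [b [b0 -> ->]]] [c [d [d0 E ->]]].
have [bS dS] := (ev_neq0 b0, ev_neq0 d0).
move/eqP: E; rewrite eqr_div ?tofrac_eq0 // -!tofracM tofrac_eq => /eqP/(congr1 e).
rewrite !rmorphM /= => E; apply/eqP.
by rewrite eqr_div ?tofrac_eq0 // -!tofracM E.
Qed.

Lemma evfD s t y z : evf s y -> evf t z -> evf (s + t) (y + z).
Proof.
move=> [a [b [b0 -> ->]]] [c [d [d0 -> ->]]].
have [bS dS] := (ev_neq0 b0, ev_neq0 d0).
exists (a * d + c * b), (b * d); rewrite !rmorphD !rmorphM /= mulf_neq0 //; split=> //.
  by rewrite addf_div ?tofrac_eq0.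
by rewrite addf_div ?tofrac_eq0.
Qed.

Lemma evfM s t y z : evf s y -> evf t z -> evf (s * t) (y * z).
Proof.
move=> [a [b [b0 -> ->]]] [c [d [d0 -> ->]]].
exists (a * c), (b * d); rewrite !rmorphM /= mulf_neq0 //; split=> //.
  by rewrite mulf_div.
by rewrite mulf_div.
Qed.

Lemma evfN s y : evf s y -> evf (- s) (- y).
Proof.
by move=> [a [b [b0 -> ->]]]; exists (- a), b; rewrite !rmorphN /= !mulNr.
Qed.

Lemma evf0 : evf 0 0.
Proof. by exists 0, 1; rewrite !rmorph1 !rmorph0 !mul0r oner_eq0. Qed.

Lemma evf_sub0 s t y : evf (s - t) 0 -> evf t y -> evf s y.
Proof. by move=> h /(evfD h); rewrite subrK add0r. Qed.

End FractionEvaluation.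

(** * Sections of sheaves of graded modules on standard open sets *)

Section SheafModules.
Variable F : numClosedFieldType.
Local Notation S := {mpoly F[3]}.
Local Notation "x %:f" := (@tofrac _ x) (at level 2, format "x %:f").

(* From here to [grestr_iso]: the notions of [Defs] over an arbitrary field. *)
Definition hpart (k : int) (g : S) : Prop :=
  match k with Posz n => g \is n.-homog | Negz _ => g = 0 end.

Definition gmodule n := int -> 'rV[S]_n -> Prop.

Definition gAR (f : S) : gmodule 3 := fun k a => (forall j, hpart k (a 0 j)) /\ syz f a.

Definition gS : gmodule 1 := fun k v => forall j, hpart k (v 0 j).

Definition gtwist (d1 d2 : int) : gmodule 2 := fun k v =>
  hpart (k - d1) (v 0 0) /\ hpart (k - d2) (v 0 1).

Definition gmul (l : S) n (M : gmodule n) : gmodule n := fun k v =>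
  exists2 m, M (k - 1) m & v = l *: m.

Definition gopen (g : S) : Prop :=
  g != 0 /\ exists2 e : nat, (0 < e)%N & g \is e.-homog.

Definition gsect n (M : gmodule n) (g : S) (s : 'rV[{fraction S}]_n) : Prop :=
  exists (i k : nat) (m : 'rV[S]_n),
    [/\ g ^+ i \is k.-homog, M k m &
        s = (tofrac (g ^+ i))^-1 *: map_mx (@tofrac S) m].

Definition gsectO (g : S) (c : {fraction S}) : Prop := gsect gS g (\row_(_ < 1) c).

Definition grestr_iso (l : S) n (M : gmodule n) m (N : gmodule m)
    (phi : S -> 'rV[{fraction S}]_n -> 'rV[{fraction S}]_m) : Prop :=
  forall g, gopen g ->
  [/\ (forall s, gsect M g s -> gsect N g (phi g s)),
      (forall c s t, gsectO g c -> gsect M g s -> gsect M g t ->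
         gsect (gmul l N) g (phi g (c *: s + t) - (c *: phi g s + phi g t))),
      (forall s, gsect M g s ->
         (gsect (gmul l N) g (phi g s) <-> gsect (gmul l M) g s)),
      (forall t, gsect N g t ->
         exists2 s, gsect M g s & gsect (gmul l N) g (phi g s - t)) &
      (forall h s, gopen h -> gsect M g s ->
         gsect (gmul l N) (g * h) (phi (g * h) s - phi g s))].

Lemma hpart0 k : hpart k 0.
Proof. by case: k => [k|k] //=; exact: rpred0. Qed.

Lemma hpart_nat (k : int) n g : k = n%:Z -> hpart k g = (g \is n.-homog).
Proof. by move=> ->. Qed.

Lemma hpartM j k g h : g \is j.-homog -> hpart k h -> hpart (j%:Z + k) (g * h).
Proof.
case: k => [k|k] gj /=; first by move=> hk; exact: (dhomogM gj hk).
by move=> ->; rewrite mulr0; apply: hpart0.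
Qed.

Lemma hpartD k g h : hpart k g -> hpart k h -> hpart k (g + h).
Proof.
case: k => [k|k] /=; first exact: rpredD.
by move=> -> ->; rewrite addr0.
Qed.

Lemma hpart_divl l k g : l != 0 -> l \is 1.-homog -> hpart k (l * g) -> hpart (k - 1) g.
Proof.
move=> l0 l1; case: k => [[|k]|k] h.
- exact: (dhomog_divl_lt l0 l1 (h : _ \is 0.-homog)).
- have -> : k.+1%:Z - 1 = k%:Z by lia.
  by apply: (dhomog_divl l0 l1); rewrite add1n.
- have g0 : g = 0 by apply: (mulfI l0); rewrite mulr0.
  by rewrite g0; exact: hpart0.
Qed.

Lemma gsectE n (M : gmodule n) g s : gsect M g s -> exists (i k : nat) m,
  [/\ g ^+ i \is k.-homog, M k m & forall j, s 0 j = (m 0 j)%:f / (g ^+ i)%:f].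
Proof.
move=> [i [k [m [gk Mm ->]]]]; exists i, k, m; split=> // j.
by rewrite !mxE mulrC.
Qed.

Lemma gsectP n (M : gmodule n) g (s : 'rV[{fraction S}]_n) (i k : nat) m :
  g ^+ i \is k.-homog -> M k m ->
  (forall j, s 0 j = (m 0 j)%:f / (g ^+ i)%:f) -> gsect M g s.
Proof.
move=> gk Mm sE; exists i, k, m; split=> //; apply/rowP => j.
by rewrite sE !mxE mulrC.
Qed.

Definition gclosed n (M : gmodule n) :=
  (forall k m m', M k m -> M k m' -> M k (m + m')) /\
  (forall j k g m, g \is j.-homog -> M k m -> M (j%:Z + k) (g *: m)).

Lemma gclosed_AR f : gclosed (gAR f).
Proof.
split=> [k m m' [hm sm] [hm' sm']|j k g m gj [hm sm]].
  by split; [move=> t; rewrite mxE; exact: hpartD | exact: syzD].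
by split; [move=> t; rewrite mxE; exact: hpartM | exact: syzZ].
Qed.

Lemma tofracX_neq0 (g : S) n : g != 0 -> (g ^+ n)%:f != 0.
Proof. by move=> g0; rewrite tofrac_eq0 expf_neq0. Qed.

Lemma gsectD n (M : gmodule n) g s t : gclosed M -> g != 0 ->
  gsect M g s -> gsect M g t -> gsect M g (s + t).
Proof.
move=> [MD MZ] g0 /gsectE[i [k [m [gk Mm sE]]]] /gsectE[i' [k' [m' [gk' Mm' tE]]]].
apply: (@gsectP _ _ _ _ (i + i') (k + k') (g ^+ i' *: m + g ^+ i *: m')).
- by rewrite exprD dhomogM.
- by apply: MD; [rewrite addnC PoszD; apply: MZ | rewrite PoszD; apply: MZ].
move=> j; rewrite mxE sE tE addf_div ?tofracX_neq0 // -!tofracM -tofracD -exprD.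
by rewrite !mxE [m 0 j * _]mulrC [m' 0 j * _]mulrC.
Qed.

Lemma gsectZ n (M : gmodule n) g c s : gclosed M -> g != 0 ->
  gsectO g c -> gsect M g s -> gsect M g (c *: s).
Proof.
move=> [MD MZ] g0 /gsectE[i [k [h [gk Mh cE]]]] /gsectE[i' [k' [m' [gk' Mm' sE]]]].
apply: (@gsectP _ _ _ _ (i + i') (k + k') (h 0 0 *: m')).
- by rewrite exprD dhomogM.
- by rewrite PoszD; apply: MZ => //; exact: Mh.
move=> j; rewrite mxE sE; have := cE 0; rewrite mxE => ->.
by rewrite mulf_div -!tofracM -exprD mxE.
Qed.

Lemma gsect_restr n (M : gmodule n) g h s e : gclosed M -> g != 0 -> h != 0 ->
  h \is e.-homog -> gsect M g s -> gsect M (g * h) s.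
Proof.
move=> [MD MZ] g0 h0 he /gsectE[i [k [m [gk Mm sE]]]].
have hi := dhomogMn i he.
apply: (@gsectP _ _ _ _ i (e * i + k) (h ^+ i *: m)).
- by rewrite exprMn mulrC dhomogM.
- by rewrite PoszD; apply: MZ.
move=> j; rewrite sE mxE exprMn; apply/eqP.
rewrite eqr_div ?tofracX_neq0 //; last by rewrite tofrac_eq0 mulf_neq0 ?expf_neq0.
by rewrite -!tofracM tofrac_eq; apply/eqP; rewrite mulrCA mulrC [m 0 j * _]mulrC.
Qed.

Section Frame.
Variables (l u v : S) (p q : 'I_3 -> F).
Hypothesis fr : frame l p q u v.
Local Notation e := (ev p q).
Local Notation evF := (evf p q).

(** Under this condition a section is zero in the quotient by [l] as soon as its restriction to the
    line vanishes, which turns the clauses of [grestr_iso] into identities in one variable. *)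
Definition saturated n (M : gmodule n) := forall k m, M k m ->
  (forall j, e (m 0 j) = 0) -> gmul l M k m.

Lemma hpart_ev_eq0 k g : hpart k g -> e g = 0 -> exists2 h, g = l * h & hpart (k - 1) h.
Proof.
move=> gk e0; have [h gE] : exists h, g = l * h.
  case: k gk => [k|k] /= gk; first exact: (ev_eq0_dvd fr gk e0).
  by exists 0; rewrite gk mulr0.
by exists h => //; apply: (hpart_divl (fr_l0 fr) (fr_l1 fr)); rewrite -gE.
Qed.

Lemma saturated_AR f : saturated (gAR f).
Proof.
move=> k m [hm sm] em.
have /choice[b bP] : forall j, exists h, m 0 j = l * h /\ hpart (k - 1) h.
  by move=> j; have [h h1 h2] := hpart_ev_eq0 (hm j) (em j); exists h.
have mE : m = l *: \row_j b j by apply/rowP => j; rewrite !mxE; exact: (proj1 (bP j)).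
exists (\row_j b j) => //; split; first by move=> j; rewrite mxE; exact: (proj2 (bP j)).
by apply: (syzZI (fr_l0 fr)); rewrite -mE.
Qed.

Lemma ord2P (P : 'I_2 -> Prop) : P 0 -> P 1 -> forall j, P j.
Proof.
move=> P0 P1 j; case: (eqVneq j 0) => [->//|j0].
by rewrite (_ : j = 1) //; apply: val_inj; case: j j0 => -[|[]].
Qed.

Lemma saturated_twist d1 d2 : saturated (gtwist d1 d2).
Proof.
move=> k m [m0 m1] em.
have [h0 E0 H0] := hpart_ev_eq0 m0 (em 0); have [h1 E1 H1] := hpart_ev_eq0 m1 (em 1).
exists (\row_(j < 2) if j == 0 then h0 else h1).
  by split; rewrite mxE /= addrAC.
by apply/rowP; apply: ord2P; rewrite !mxE.
Qed.

Lemma evf_gmul n (M : gmodule n) g s : e g != 0 -> gsect (gmul l M) g s ->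
  forall j, evF (s 0 j) 0.
Proof.
move=> g0 /gsectE[i [k [_ [_ [m _ ->] sE]]]] j; rewrite sE mxE.
have gi : e (g ^+ i) != 0 by rewrite rmorphXn expf_neq0.
have := evf_frac (l * m 0 j) gi.
by rewrite (rmorphM (ev p q)) /= (ev_l fr) mul0r rmorph0 mul0r.
Qed.

Lemma gmul_of_evf n (M : gmodule n) g s : saturated M -> e g != 0 -> gsect M g s ->
  (forall j, evF (s 0 j) 0) -> gsect (gmul l M) g s.
Proof.
move=> satM g0 /gsectE[i [k [m [gk Mm sE]]]] s0.
have gi : e (g ^+ i) != 0 by rewrite rmorphXn expf_neq0.
apply: (gsectP gk _ sE); apply: satM => // j.
have := s0 j; rewrite sE => h; have /esym/eqP := evf_uniq h (evf_frac (m 0 j) gi).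
by rewrite mulf_eq0 invr_eq0 !tofrac_eq0 (negPf gi) orbF => /eqP.
Qed.

Lemma hom_uv i j : (u ^+ i * v ^+ j) \is (i + j).-homog.
Proof.
by have := dhomogM (dhomogMn i (fr_u1 fr)) (dhomogMn j (fr_v1 fr)); rewrite !mul1n.
Qed.

Lemma u_neq0 : u != 0.
Proof. by apply: (@ev_neq0 _ p q); rewrite (ev_u fr) oner_eq0. Qed.

Lemma v_neq0 : v != 0.
Proof. by apply: (@ev_neq0 _ p q); rewrite (ev_v fr) polyX_eq0. Qed.

Lemma gopen_u : gopen u.
Proof. by split; [exact: u_neq0 | exists 1%N => //; exact: (fr_u1 fr)]. Qed.

Lemma gopen_v : gopen v.
Proof. by split; [exact: v_neq0 | exists 1%N => //; exact: (fr_v1 fr)]. Qed.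

Lemma gopen_uv : gopen (u * v).
Proof.
split; first by rewrite mulf_neq0 ?u_neq0 ?v_neq0.
by exists 2%N => //; have := hom_uv 1 1; rewrite !expr1.
Qed.

(* The transition function [(v / u) ^ (a - b)] on [D_+(u v)]. *)
Definition transition a b : {fraction S} :=
  (v ^+ (a + a) * u ^+ (b + b))%:f / ((u * v) ^+ (a + b))%:f.

Lemma gsectO_transition a b : gsectO (u * v) (- transition a b).
Proof.
apply: (@gsectP 1 gS _ _ (a + b) (a + b + (a + b))
  (\row_j (- (v ^+ (a + a) * u ^+ (b + b))))).
- by rewrite exprMn; exact: hom_uv.
- move=> j; rewrite mxE /= rpredN mulrC (_ : a + b + (a + b) = b + b + (a + a))%N; last by lia.
  exact: hom_uv.
- by move=> j; rewrite !mxE /transition rmorphN mulNr.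
Qed.

Lemma e_uv k : e ((u * v) ^+ k) = 'X^k.
Proof. by rewrite rmorphXn rmorphM /= (ev_u fr) (ev_v fr) mul1r. Qed.

Lemma evf_transition a b : evF (transition a b) (('X^(a + a))%:f / ('X^(a + b))%:f).
Proof.
have E : e (v ^+ (a + a) * u ^+ (b + b)) = 'X^(a + a).
  by rewrite rmorphM !rmorphXn /= (ev_u fr) (ev_v fr) expr1n mulr1.
have := @evf_frac _ p q (v ^+ (a + a) * u ^+ (b + b)) ((u * v) ^+ (a + b)).
by rewrite e_uv E; apply; rewrite expf_neq0 // polyX_eq0.
Qed.

Lemma evf_frac_u g n : evF (g%:f / (u ^+ n)%:f) (e g)%:f.
Proof.
have E : e (u ^+ n) = 1 by rewrite rmorphXn /= (ev_u fr) expr1n.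
by have := @evf_frac _ p q g (u ^+ n); rewrite E rmorph1 divr1; apply; exact: oner_neq0.
Qed.

Lemma evf_frac_v g n : evF (g%:f / (v ^+ n)%:f) ((e g)%:f / ('X^n)%:f).
Proof.
have E : e (v ^+ n) = 'X^n by rewrite rmorphXn /= (ev_v fr).
by have := @evf_frac _ p q g (v ^+ n); rewrite E; apply; rewrite expf_neq0 ?polyX_eq0.
Qed.

Lemma gsect_compare f a b su sv : gsect (gAR f) u su -> gsect (gAR f) v sv ->
  [/\ gsect (gAR f) (u * v) su, gsect (gAR f) (u * v) sv &
     gsect (gAR f) (u * v) (- transition a b *: sv + su)].
Proof.
move=> hu hv; have [uv0 _] := gopen_uv; have cl := gclosed_AR f.
have hu' := gsect_restr cl u_neq0 v_neq0 (fr_v1 fr) hu.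
have hv' : gsect (gAR f) (u * v) sv.
  by rewrite mulrC; exact: (gsect_restr cl v_neq0 u_neq0 (fr_u1 fr) hv).
split=> //; apply: gsectD => //; apply: gsectZ => //; exact: gsectO_transition.
Qed.

Section Splitting.
Variables (f : S) (d1 d2 : int).
Variable phi : S -> 'rV[{fraction S}]_3 -> 'rV[{fraction S}]_2.
Hypothesis phi_iso : grestr_iso l (gAR f) (gtwist d1 d2) phi.
Local Notation M := (gAR f).
Local Notation N := (gtwist d1 d2).

(* On [D_+(u v)], [phi] is linear and compatible with restrictions modulo [l]. *)
Lemma evf_phi a b su sv j yu yv : gsect M u su -> gsect M v sv ->
  evF (phi u su 0 j) yu -> evF (phi v sv 0 j) yv ->
  evF (phi (u * v) (- transition a b *: sv + su) 0 j)
    (yu - ('X^(a + a))%:f / ('X^(a + b))%:f * yv).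
Proof.
move=> hu hv eu ev; have [hu' hv' _] := gsect_compare a b hu hv.
have uv1 : e (u * v) != 0 by have := e_uv 1; rewrite !expr1 => ->; rewrite polyX_eq0.
have [_ lin _ _ _] := phi_iso gopen_uv; have [_ _ _ _ ru] := phi_iso gopen_u.
have [_ _ _ _ rv] := phi_iso gopen_v.
have ru' := evf_gmul uv1 (ru _ _ gopen_v hu) j.
have rv' : evF ((phi (u * v) sv - phi v sv) 0 j) 0.
  by rewrite [u * v]mulrC; apply: (evf_gmul _ (rv _ _ gopen_u hv)); rewrite mulrC.
have li := evf_gmul uv1 (lin _ _ _ (gsectO_transition a b) hv' hu') j.
move: ru' rv' li; rewrite !mxE => ru' rv' li.
apply: (evf_sub0 li); rewrite addrC; apply: evfD; first exact: (evf_sub0 ru' eu).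
rewrite -[- (_ * yv)]mulNr; apply: evfM; last exact: (evf_sub0 rv' ev).
by apply: evfN; exact: evf_transition.
Qed.

Lemma ev_u_neq0 : e u != 0. Proof. by rewrite (ev_u fr) oner_eq0. Qed.
Lemma ev_v_neq0 : e v != 0. Proof. by rewrite (ev_v fr) polyX_eq0. Qed.
Lemma ev_uv_neq0 : e (u * v) != 0.
Proof. by rewrite rmorphM mulf_neq0 ?ev_u_neq0 ?ev_v_neq0. Qed.

Lemma homog_unique (x : S) i k : x != 0 -> x \is 1.-homog -> x ^+ i \is k.-homog -> k = i.
Proof.
move=> x0 x1 xk; apply: (dhomog_uniq _ xk); first exact: expf_neq0.
by have := dhomogMn i x1; rewrite mul1n.
Qed.

Lemma tofracX n : ('X^n : {poly F})%:f != 0 :> {fraction {poly F}}.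
Proof. by rewrite tofrac_eq0 expf_neq0 // polyX_eq0. Qed.

(* The generator of the summand [O(-d1)] of [E_L] is a section of [E_L(d1)]. *)
Lemma has_section_splitting : has_section f p q d1.
Proof.
have [a [b dE]] : exists a b : nat, d1 = a%:Z - b%:Z.
  by exists `|Num.max d1 0|%N, `|Num.min d1 0|%N; lia.
have [_ _ su_iso su_surj _] := phi_iso gopen_u.
have [_ _ _ sv_surj _] := phi_iso gopen_v.
have [_ _ suv_iso _ _] := phi_iso gopen_uv.
(* The local generator [x ^ (b - a) = x ^ (- d1)] of the first summand, written without negative
   exponents. *)
pose t x : 'rV[{fraction S}]_2 :=
  \row_j (if j == 0 then (x ^+ (b + b))%:f / (x ^+ (a + b))%:f else 0).
have tN (x : S) : x \is 1.-homog -> gsect N x (t x).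
  move=> x1; apply: (@gsectP _ N _ _ (a + b) (a + b) (\row_j if j == 0 then x ^+ (b + b) else 0)).
  - by have := dhomogMn (a + b) x1; rewrite mul1n.
  - split; rewrite mxE /=; last exact: hpart0.
    rewrite (hpart_nat (n := b + b)); last by lia.
    by have := dhomogMn (b + b) x1; rewrite mul1n.
  - by move=> j; rewrite !mxE; case: ifP; rewrite ?rmorph0 ?mul0r.
have [su hsu eu] := su_surj _ (tN _ (fr_u1 fr)).
have [sv hsv ev'] := sv_surj _ (tN _ (fr_v1 fr)).
have tu j : evF (phi u su 0 j) (if j == 0 then 1 else 0).
  have := evf_gmul ev_u_neq0 eu j; rewrite !mxE => h; apply: (evf_sub0 h).
  case: ifP => _; last exact: evf0.
  have := evf_frac_u (u ^+ (b + b)) (a + b).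
  by rewrite [e _]rmorphXn /= (ev_u fr) expr1n rmorph1.
have tv j : evF (phi v sv 0 j) (if j == 0 then ('X^(b + b))%:f / ('X^(a + b))%:f else 0).
  have := evf_gmul ev_v_neq0 ev' j; rewrite !mxE => h; apply: (evf_sub0 h).
  case: ifP => _; last exact: evf0.
  have := evf_frac_v (v ^+ (b + b)) (a + b).
  by rewrite [e _]rmorphXn /= (ev_v fr).
have [hu' hv' hw] := gsect_compare a b hsu hsv.
have w0 : gsect (gmul l M) (u * v) (- transition a b *: sv + su).
  apply/(suv_iso _ hw); apply: (gmul_of_evf (@saturated_twist d1 d2) ev_uv_neq0).
    by have [h _ _ _ _] := phi_iso gopen_uv; apply: h.
  move=> j; have := evf_phi a b hsu hsv (tu j) (tv j).
  case: ifP => _; last by rewrite mulr0 subr0.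
  rewrite mulf_div -!tofracM -!exprD (_ : (a + a + (b + b) = a + b + (a + b))%N); last by lia.
  by rewrite divff ?tofracX // subrr.
have [i [k [m1 [uk [hm1 sm1] suE]]]] := gsectE hsu.
have [i' [k' [m2 [vk [hm2 sm2] svE]]]] := gsectE hsv.
have ki := homog_unique u_neq0 (fr_u1 fr) uk.
have ki' := homog_unique v_neq0 (fr_v1 fr) vk.
have rel j : ('X^(a + a))%:f / ('X^(a + b))%:f * ((e (m2 0 j))%:f / ('X^i')%:f) = (e (m1 0 j))%:f.
  have h1 := evf_gmul ev_uv_neq0 w0 j.
  have hu1 : evF (su 0 j) (e (m1 0 j))%:f by rewrite suE; exact: evf_frac_u.
  have hv1 : evF (sv 0 j) ((e (m2 0 j))%:f / ('X^i')%:f) by rewrite svE; exact: evf_frac_v.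
  have := evfD (evfM (evfN (evf_transition a b)) hv1) hu1.
  move: h1; rewrite !mxE => h1 /(evf_uniq h1)/esym/eqP.
  by rewrite mulNr addrC subr_eq0 => /eqP ->.
(* A common degree for both halves; the summand [a] in [n] makes the subtraction exact, so that
   [n = P + d1]. *)
pose n := (i + i' + a)%N; pose P := (n + b - a)%N.
have s1 : syzh f n (u ^+ (i' + a) *: m1).
  have -> : n = (i' + a + k)%N by rewrite ki /n; lia.
  by apply: syzhZ; [have := dhomogMn (i' + a) (fr_u1 fr); rewrite mul1n | split].
have s2 : syzh f n (v ^+ (i + a) *: m2).
  have -> : n = (i + a + k')%N by rewrite ki' /n; lia.
  by apply: syzhZ; [have := dhomogMn (i + a) (fr_v1 fr); rewrite mul1n | split].
exists P, n, (u ^+ (i' + a) *: m1), (v ^+ (i + a) *: m2); split=> //.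
- by rewrite /P /n; lia.
- apply/rowP => j; rewrite !mxE !rmorphM !rmorphXn /= (ev_u fr) (ev_v fr) expr1n mul1r.
  apply/eqP; rewrite -tofrac_eq !tofracM -(rel j) /P /n; apply/eqP.
  rewrite mulf_div -!tofracM -exprD [RHS]mulrA -tofracM.
  apply: (canRL (mulfK (tofracX _))); rewrite -!tofracM; congr (_%:f).
  rewrite mulrAC -exprD mulrA -exprD; congr (_ * _); congr ('X^_); lia.
- apply/eqP => m10.
  have ev1 j : e (m1 0 j) = 0.
    by have /rowP/(_ j) := m10; rewrite !mxE rmorphM rmorphXn /= (ev_u fr) expr1n mul1r.
  have : gsect (gmul l M) u su.
    apply: (gmul_of_evf (@saturated_AR f) ev_u_neq0 hsu) => j.
    by have := evf_frac_u (m1 0 j) i; rewrite suE ev1 rmorph0.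
  move/(su_iso _ hsu) => /(evf_gmul ev_u_neq0)/(_ 0) h.
  by have /eqP := evf_uniq h (tu 0); rewrite eq_sym oner_eq0.
Qed.

(** The image of the section in the split bundle has a nonzero component, a section of
    [O_L(k - dj)], so [dj <= k] for [d1] or for [d2]. *)
Lemma splitting_le_section k : d1 <= d2 -> has_section f p q k -> d1 <= k.
Proof.
move=> d12 [P [n [m1 [m2 [nE s1 s2 E m10]]]]].
have [a [b kE]] : exists a b : nat, k = a%:Z - b%:Z.
  by exists `|Num.max k 0|%N, `|Num.min k 0|%N; lia.
have [hphiu _ su_iso _ _] := phi_iso gopen_u.
have [hphiv _ _ _ _] := phi_iso gopen_v.
have [_ _ suv_iso _ _] := phi_iso gopen_uv.
have un : u ^+ n \is n.-homog by have := dhomogMn n (fr_u1 fr); rewrite mul1n.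
have vn : v ^+ n \is n.-homog by have := dhomogMn n (fr_v1 fr); rewrite mul1n.
pose su : 'rV[{fraction S}]_3 := \row_j ((m1 0 j)%:f / (u ^+ n)%:f).
pose sv : 'rV[{fraction S}]_3 := \row_j ((m2 0 j)%:f / (v ^+ n)%:f).
have hsu : gsect M u su.
  apply: (gsectP un (m := m1)) => [|j]; last by rewrite mxE.
  by split; [exact: (proj2 s1) | exact: (proj1 s1)].
have hsv : gsect M v sv.
  apply: (gsectP vn (m := m2)) => [|j]; last by rewrite mxE.
  by split; [exact: (proj2 s2) | exact: (proj1 s2)].
have eu j : evF (su 0 j) (e (m1 0 j))%:f by rewrite mxE; exact: evf_frac_u.
have ev' j : evF (sv 0 j) ((e (m2 0 j))%:f / ('X^n)%:f) by rewrite mxE; exact: evf_frac_v.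
have [_ _ hw] := gsect_compare a b hsu hsv.
have w0 : gsect (gmul l M) (u * v) (- transition a b *: sv + su).
  apply: (gmul_of_evf (@saturated_AR f) ev_uv_neq0 hw) => j; rewrite !mxE.
  have := evfD (evfM (evfN (evf_transition a b)) (ev' j)) (eu j); rewrite !mxE.
  have /rowP/(_ j) := E; rewrite !mxE => ->; rewrite tofracM.
  suff -> : - (('X^(a + a))%:f / ('X^(a + b))%:f) *
    (('X^P)%:f * (e (m1 0 j))%:f / ('X^n)%:f) + (e (m1 0 j))%:f = 0 :> {fraction {poly F}} by [].
  rewrite mulNr addrC; apply/eqP; rewrite subr_eq0; apply/eqP.
  rewrite mulf_div -!tofracM; apply: (canRL (mulfK _)).
    by rewrite tofracM mulf_neq0 ?tofracX.
  rewrite -tofracM; congr (_%:f); rewrite mulrA -!exprD mulrC; congr (_ * _).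
  congr ('X^_); lia.
have [hu' hv'] := (hphiu _ hsu, hphiv _ hsv).
have [i [g [A [ui NA AE]]]] := gsectE hu'.
have [i' [g' [B [vi NB BE]]]] := gsectE hv'.
have gi := homog_unique u_neq0 (fr_u1 fr) ui.
have gi' := homog_unique v_neq0 (fr_v1 fr) vi.
have eA j : evF (phi u su 0 j) (e (A 0 j))%:f by rewrite AE; exact: evf_frac_u.
have eB j : evF (phi v sv 0 j) ((e (B 0 j))%:f / ('X^i')%:f) by rewrite BE; exact: evf_frac_v.
have rel j : 'X^(a + a) * e (B 0 j) = 'X^(a + b + i') * e (A 0 j).
  have h0 := evf_gmul ev_uv_neq0 ((suv_iso _ hw).2 w0) j.
  have /eqP := evf_uniq h0 (evf_phi a b hsu hsv (eA j) (eB j)).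
  rewrite eq_sym subr_eq0 mulf_div -!tofracM -exprD => /eqP h.
  apply/eqP; rewrite -tofrac_eq tofracM [X in _ == X]tofracM h [X in _ == X]mulrC.
  by rewrite divfK ?tofracX // tofracM.
have bound j dj : hpart (g'%:Z - dj) (B 0 j) -> e (A 0 j) != 0 -> dj <= k.
  move=> hB A0.
  have B0 : e (B 0 j) != 0.
    apply: contraNneq A0 => B0; have /eqP := rel j.
    by rewrite B0 mulr0 eq_sym mulf_eq0 expf_eq0 polyX_eq0 andbF.
  have sB : (size (e (B 0 j)))%:Z <= g'%:Z - dj + 1.
    case: (g'%:Z - dj) hB => [z|z] /= hB; last by rewrite hB rmorph0 eqxx in B0.
    by have := size_ev p q hB; move: (size _) => x; lia.
  have := congr1 (fun T : {poly F} => size T) (rel j).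
  rewrite !size_mul ?expf_neq0 ?polyX_eq0 // !size_polyXn.
  move: A0; rewrite -size_poly_gt0; move: (size _) (size _) sB => x y; lia.
have [A00|A00] := eqVneq (e (A 0 0)) 0; last exact: (bound _ _ (proj1 NB) A00).
have [A01|A01] := eqVneq (e (A 0 1)) 0; last first.
  by apply: le_trans d12 _; exact: (bound _ _ (proj2 NB) A01).
have A0 j : e (A 0 j) = 0 by move: j; apply: ord2P.
have : gsect (gmul l M) u su.
  apply/(su_iso _ hsu); apply: (gmul_of_evf (@saturated_twist d1 d2) ev_u_neq0 hu') => j.
  by have := eA j; rewrite A0 rmorph0.
move=> /(evf_gmul ev_u_neq0) su0; case/negP: m10; apply/eqP/rowP => j.
have /eqP := evf_uniq (eu j) (su0 j).
by rewrite tofrac_eq0 !mxE => /eqP.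
Qed.

End Splitting.
End Frame.
End SheafModules.

(** * Pencils of lines *)

Lemma meval_muni (F : fieldType) n (x : 'I_n.+1 -> F) (G : {mpoly F[n.+1]}) :
  G.@[x] = (map_poly (meval (fun i => x (widen_ord (leqnSn n) i))) (muni G)).[x ord_max].
Proof.
rewrite {2}(mpolyE G) (raddf_sum (@muni n F)) (raddf_sum (map_poly _)) horner_sum mevalE.
apply: eq_bigr => m _ /=; rewrite muniZ muniX -mul_polyC !rmorphM /= map_polyC map_polyXn.
rewrite hornerM hornerC hornerM hornerXn map_polyC hornerC /= mevalC mevalX big_ord_recr /=.
by congr (_ * (_ * _)); apply: eq_bigr => i _; rewrite mnmE.
Qed.

Lemma mpoly_nonroot (F : closedFieldType) n (G : {mpoly F[n]}) :
  G != 0 -> exists x, G.@[x] != 0.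
Proof.
elim: n G => [|n IH] G G0.
  have GE := nvar0_mpolyC G; exists (fun _ => 0).
  by rewrite GE mevalC; apply: contraNneq G0 => c0; rewrite GE c0.
have mG0 : muni G != 0.
  by apply: contraNneq G0 => mG0; rewrite -(muniK G) mG0 raddf0.
have lG0 : lead_coef (muni G) != 0 by rewrite lead_coef_eq0.
have [x xP] := IH _ lG0.
have P0 : map_poly (meval x) (muni G) != 0.
  apply: contraNneq xP => P0; rewrite lead_coefE.
  by have := congr1 (fun P : {poly F} => P`_(size (muni G)).-1) P0; rewrite coef_map coef0 => ->.
have [t] := closed_nonrootP _ P0.
rewrite rootE => tP; exists (fun i => if unlift ord_max i is Some j then x j else t).
rewrite meval_muni unlift_none; congr (_ != 0): tP; congr (_.[t]); apply: eq_map_poly.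
move=> c; apply: meval_eq => i.
rewrite (_ : widen_ord _ i = lift ord_max i) ?liftK //.
by apply: val_inj; rewrite /= /bump leqNgt ltn_ord.
Qed.

Section Lines.
Variable F : numClosedFieldType.
Local Notation S := {mpoly F[3]}.
Implicit Types a : 'I_3 -> F.

Definition gline a : S := \sum_(i < 3) a i *: 'X_i.

Lemma meval_gline a x : (gline a).@[x] = \sum_(i < 3) a i * x i.
Proof.
by rewrite /gline raddf_sum; apply: eq_bigr => i _; rewrite /= mevalZ mevalXU.
Qed.

Section Coordinates.
Variables i j k : 'I_3.
Hypotheses (ij : i != j) (ik : i != k) (jk : j != k).

Lemma ijk_cover t : [|| t == i, t == j | t == k].
Proof.
move: ij ik jk; rewrite -!val_eqE /=.
have := (ltn_ord i, ltn_ord j, ltn_ord k, ltn_ord t); case=> -[[]] /=; lia.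
Qed.

Lemma sum_ijk (V : nmodType) (G : 'I_3 -> V) : \sum_(t < 3) G t = G i + G j + G k.
Proof.
rewrite (bigD1 i) //= (bigD1 j) ?[j == i]eq_sym //= (bigD1 k) /=; last first.
  by rewrite eq_sym ik eq_sym jk.
rewrite big1 ?addr0 ?addrA // => t /andP[/andP[ti tj] tk].
by have := ijk_cover t; rewrite (negPf ti) (negPf tj) (negPf tk).
Qed.

Definition line_p a t : F := if t == i then 1 else if t == k then - (a i / a k) else 0.
Definition line_q a t : F := if t == j then 1 else if t == k then - (a j / a k) else 0.

Lemma line_frame a : a k != 0 -> frame (gline a) (line_p a) (line_q a) 'X_i 'X_j.
Proof.
move=> ak0; have [ji ki kj] : [/\ j != i, k != i & k != j] by split; rewrite eq_sym.
have X1 (t : 'I_3) : ('X_t : S) \is 1.-homog by rewrite dhomogX /= mdeg1.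
split=> //.
- have : (gline a).@[fun t => (t == k)%:R] != 0.
    rewrite meval_gline (bigD1 k) //= eqxx mulr1 big1 ?addr0 // => t tk.
    by rewrite (negPf tk) mulr0.
  by apply: contraNneq => ->; rewrite meval0.
- by apply: rpred_sum => t _; apply: rpredZ.
- move=> x y; rewrite mevalXU /line_p /line_q eqxx (negPf ij) (negPf ik).
  by rewrite mulr1 mulr0 addr0.
- move=> x y; rewrite mevalXU /line_p /line_q eqxx (negPf ji) (negPf jk).
  by rewrite mulr1 mulr0 add0r.
- move=> x y; rewrite meval_gline sum_ijk /line_p /line_q !eqxx.
  rewrite (negPf ij) (negPf ik) (negPf jk) (negPf ji) (negPf ki) (negPf kj).
  by field.
- exists (fun t => if t == k then (a k)^-1 else 0) => t.
  rewrite /gline sum_ijk /line_p /line_q.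
  have [->|ti] := eqVneq t i.
    by rewrite (negPf ij) (negPf ik) scale1r !scale0r !addr0.
  have [->|tj] := eqVneq t j.
    by rewrite (negPf jk) scale1r !scale0r add0r addr0.
  have [->|tk] := eqVneq t k; last first.
    by have := ijk_cover t; rewrite (negPf ti) (negPf tj) (negPf tk).
  rewrite !scalerDr !scalerA mulVf // scale1r !scaleNr ![(a k)^-1 * _]mulrC.
  by rewrite -opprD addrA addNr add0r.
Qed.

Definition pencil a (b : 'I_3 -> F) t s : F := a s + t * (b s - a s).

(** The pencil is used with [b k = a k]: the constant denominator [a k] keeps the two base points
    polynomial in the parameter. *)
Definition pencil_p a (b : 'I_3 -> F) s : {poly F} :=
  if s == i then 1 else
  if s == k then - ((a k)^-1 *: ((a i)%:P + (b i - a i) *: 'X)) else 0.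
Definition pencil_q a (b : 'I_3 -> F) s : {poly F} :=
  if s == j then 1 else
  if s == k then - ((a k)^-1 *: ((a j)%:P + (b j - a j) *: 'X)) else 0.

Lemma pencil_frame a (b : 'I_3 -> F) : a k != 0 -> b k = a k -> forall t,
  frame (gline (pencil a b t)) (fun s => (pencil_p a b s).[t]) (fun s => (pencil_q a b s).[t])
    'X_i 'X_j.
Proof.
move=> ak0 bk t; have pk : pencil a b t k = a k by rewrite /pencil bk subrr mulr0 addr0.
have := @line_frame (pencil a b t); rewrite pk => /(_ ak0).
rewrite (_ : line_p (pencil a b t) = fun s => (pencil_p a b s).[t]); last first.
  apply: funext => s; rewrite /line_p /pencil_p pk; case: ifP => _; first by rewrite hornerC.
  by case: ifP => _; rewrite ?hornerE // /pencil mulrC [t * _]mulrC.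
rewrite (_ : line_q (pencil a b t) = fun s => (pencil_q a b s).[t]) //.
apply: funext => s; rewrite /line_q /pencil_q pk; case: ifP => _; first by rewrite hornerC.
by case: ifP => _; rewrite ?hornerE // /pencil mulrC [t * _]mulrC.
Qed.

End Coordinates.

Definition gsplitting (f : S) a d1 d2 :=
  d1 <= d2 /\ exists phi, grestr_iso (gline a) (gAR f) (gtwist d1 d2) phi.

Theorem splitting_avoiding (d r : nat) (f : S) (rho : 'rV[S]_3) (a : 'I_3 -> F) (d1 d2 : int) :
  (0 < d)%N -> f \is d.-homog -> f != 0 ->
  (forall g h, f = g ^+ 2 * h -> exists c : F, g = c%:MP) ->
  syzh f r rho -> rho != 0 -> (forall k b, (k < r)%N -> syzh f k b -> b = 0) ->
  (exists k, a k != 0) ->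
  (forall x, (exists j, x j != 0) ->
     (forall h b, syz f b -> det_euler rho b = f * h -> h.@[x] = 0) -> (gline a).@[x] != 0) ->
  gsplitting f a d1 d2 -> (d < 2 * r)%N ->
  d%:Z - 1 - r%:Z <= d1 /\
  ((2 * r <= d + 2)%N -> forall e1 e2 m (G : S), G \is m.-homog -> G != 0 ->
     (forall b, (exists k, b k != 0) -> G.@[b] != 0 -> gsplitting f b e1 e2) ->
   d1 = e1 - 1 \/ d1 = e1).
Proof.
move=> d0 fd f0 sqf rhoP rho0 rmin [k ak0] avoid spl dr.
have [i [j [ij ik jk]]] : exists i j : 'I_3, [/\ i != j, i != k & j != k].
  by move: k {ak0}; apply: ord3P; [exists i1, i2|exists i0, i2|exists i0, i1].
have upper l p q u v : frame l p q u v -> Zfree f d r rho p q -> Zfree f d r rho q p ->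
    (2 * r <= d + 2)%N -> has_section f p q (d%:Z - r%:Z).
  move=> fr Z1 Z2 dr2.
  have [K [n [m [m' [K3 ZP]]]]] := ZpairP d0 fd f0 sqf rhoP rho0 3 fr Z1 Z2.
  by apply: (section_upper d0 fd f0 sqf rhoP rho0 fr ZP K3); rewrite dr.
have avoid_om x : (exists j, x j != 0) ->
    (forall b, syz f b -> (omega f rho b).@[x] = 0) -> (gline a).@[x] != 0.
  move=> x0 h; apply: avoid => // g b sb E.
  by rewrite -(omega_eq f0 E) h.
have fr := line_frame ij ik jk ak0.
have Z1 := Zfree_of_avoid d0 fd f0 sqf rhoP rho0 fr avoid_om.
have Z2 := Zfree_of_avoid d0 fd f0 sqf rhoP rho0 (frame_swap fr) avoid_om.
have lower := section_lower d0 fd f0 sqf rhoP rho0 rmin.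
case: spl => d12 [phi iso].
have d1_low := lower _ _ _ _ _ fr _ Z1 Z2 (ltnW dr) (has_section_splitting fr iso).
split=> // dr2 e1 e2 m G Gm G0 splG.
have d1_up := splitting_le_section fr iso d12 (upper _ _ _ _ _ fr Z1 Z2 dr2).
(* A point off the zeros of [G * X_k], rescaled; homogeneity of [G] keeps its value nonzero. *)
have [b bk bG] : exists2 b : 'I_3 -> F, b k = a k & G.@[b] != 0.
  have Xk0 : ('X_k : S) != 0.
    by apply/negP => /eqP/(congr1 (mcoeff U_(k))); rewrite mcoeffX eqxx mcoeff0 => /eqP/negP[];
       rewrite oner_eq0.
  have GX0 : G * 'X_k != 0 by rewrite mulf_neq0.
  have [c] := mpoly_nonroot GX0; rewrite mevalM mevalXU mulf_eq0 negb_or => /andP[Gc ck].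
  exists (fun t => a k / c k * c t); first by rewrite divfK.
  by rewrite (mevalZ_homog _ _ Gm) mulf_neq0 // expf_neq0 // mulf_neq0 ?invr_eq0.
have frP := pencil_frame ij ik jk ak0 bk.
have pa : gline (pencil a b 0) = gline a.
  by apply: eq_bigr => t _; rewrite /pencil mul0r addr0.
have fr0 : frame (gline a) (fun s => (pencil_p i k a b s).[0])
    (fun s => (pencil_q j k a b s).[0]) 'X_i 'X_j by rewrite -pa; exact: frP.
have Z1' := Zfree_of_avoid d0 fd f0 sqf rhoP rho0 fr0 avoid_om.
have Z2' := Zfree_of_avoid d0 fd f0 sqf rhoP rho0 (frame_swap fr0) avoid_om.
have drd : (d < 2 * r <= d + 2)%N by rewrite dr.
have [D D0 DP] := generic_line d0 fd f0 sqf rhoP rho0 frP Z1' Z2' drd.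
(* [G] along the pencil, with [g.[1] = G.@[b]]; off the roots of [D * g] the line has splitting type
   [(e1, e2)] and the open conditions hold. *)
pose g : {poly F} := ev a (fun t => b t - a t) G.
have g0 : g != 0.
  apply: contraNneq bG => g0; have := horner_ev a (fun t => b t - a t) G 1.
  rewrite -/g g0 horner0 => /eqP; rewrite eq_sym.
  by rewrite (_ : G.@[_] = G.@[b]) //; apply: meval_eq => t; rewrite mul1r addrC subrK.
have [t] := closed_nonrootP _ (mulf_neq0 D0 g0).
rewrite rootE hornerM mulf_eq0 negb_or => /andP[/DP[Zt1 Zt2 spec_t] gt].
have [e12 [psi iso_t]] : gsplitting f (pencil a b t) e1 e2.
  apply: splG; last by move: gt; rewrite horner_ev.
  by exists k; rewrite /pencil bk subrr mulr0 addr0.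
have frt := frP t.
have e1_sec := has_section_splitting frt iso_t.
have e1_low := lower _ _ _ _ _ frt _ Zt1 Zt2 (ltnW dr) e1_sec.
have e1_up := splitting_le_section frt iso_t e12 (upper _ _ _ _ _ frt Zt1 Zt2 dr2).
(* Both [d1] and [e1] are now [d - 1 - r] or [d - r]; this excludes the remaining bad case
   [d1 = e1 + 1]. *)
have d1_eq : e1 = d%:Z - 1 - r%:Z -> d1 <= d%:Z - 1 - r%:Z.
  move=> e1E; rewrite e1E in e1_sec.
  exact: (splitting_le_section fr0 iso d12 (spec_t e1_sec)).
by clear -d1_low d1_up e1_low e1_up d1_eq; lia.
Qed.

End Lines.

Theorem theorem5p7 (R : realType) (d r : nat) (f : Sring R)
    (rho1 : 'rV[Sring R]_3)
    (d_gt0 : (0 < d)%N) (f_homog : f \is d.-homog) (f_neq0 : f != 0)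
    (f_reduced : squarefree f) (mdr_f : is_mdr f r)
    (rho1_AR : AR f r rho1) (rho1_neq0 : rho1 != 0)
    (a : 'I_3 -> complex R) (a_neq0 : nonzero_vec a)
    (avoid : line_avoids_Z f rho1 a)
    (d1 d2 : int) (split_L : splitting_type f a d1 d2) :
  (d < 2 * r)%N ->
  d%:Z - 1 - r%:Z <= d1 /\
  (2 * r%:Z - d%:Z = 1 \/ 2 * r%:Z - d%:Z = 2 ->
   forall e1 e2 : int, generic_splitting_type f e1 e2 ->
   d1 = e1 - 1 \/ d1 = e1).
Proof.
move=> dr; pose C : numClosedFieldType := complex R.
have splE b c1 c2 : splitting_type f b c1 c2 -> @gsplitting C f b c1 c2 by [].
have rhoP : @syzh C f r rho1 by case: rho1_AR.
have rmin k (b : 'rV[Sring R]_3) : (k < r)%N -> @syzh C f k b -> b = 0.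
  by move=> kr [sb hb]; apply: (mdr_f.2 k kr).
have av x : (exists j, x j != 0) -> (forall h b, @syz C f b ->
    @det_euler C rho1 b = f * h -> h.@[x] = 0) -> (@gline C a).@[x] != 0.
  move=> x0 hx; apply: avoid; split=> // h [b sb E]; apply: (hx h b sb).
  by rewrite -E /Delta det3E /det_euler /det3 !mxE.
have [low gen] := @splitting_avoiding C d r f rho1 a d1 d2 d_gt0 f_homog f_neq0 f_reduced
  rhoP rho1_neq0 rmin a_neq0 av (splE _ _ _ split_L) dr.
split=> // dr2 e1 e2 [m [G [Gm G0 GP]]]; apply: (gen _ e1 e2 m G) => //.
by clear -dr2; lia.
Qed.
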